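(* Let $\alpha\in(0,1)$, $T>0$, let $\rho,l,c_1,c_2,k_1,k_2,\mu_\alpha$ be positive constants and let $U_i<U_m<U_0$. Put $\lambda_j^2=\frac{k_j}{\rho c_j}$ ($\lambda_j>0$), $\lambda_{\alpha_j}=\lambda_j\sqrt{\mu_\alpha}$, $k_{\alpha_j}=k_j\mu_\alpha$ for $j=1,2$, and $\lambda=\frac{\lambda_{\alpha_1}}{\lambda_{\alpha_2}}=\frac{\lambda_1}{\lambda_2}>0$. Then an explicit solution of the two-phase fractional Stefan-like problem for the Riemann--Liouville derivative (problem (P) of the context) is given by $$w_2(x,t)=U_0-\frac{U_0-U_m}{1-W\left(-2\eta_\alpha\lambda,-\frac{\alpha}{2},1\right)}\left[1-W\left(-\frac{x}{\lambda_{\alpha_2}t^{\alpha/2}},-\frac{\alpha}{2},1\right)\right],$$ $$w_1(x,t)=U_i+\frac{U_m-U_i}{W\left(-2\eta_\alpha,-\frac{\alpha}{2},1\right)}\,W\left(-\frac{x}{\lambda_{\alpha_1}t^{\alpha/2}},-\frac{\alpha}{2},1\right),$$ $$r(t)=2\eta_\alpha\lambda_{\alpha_1}t^{\alpha/2},$$ where $\eta_\alpha$ is the unique positive solution to the equation $$\frac{k_{\alpha_2}(U_0-U_m)}{\lambda_{\alpha_1}\lambda_{\alpha_2}}G_2(2\lambda x)-\frac{k_{\alpha_1}(U_m-U_i)}{\lambda_{\alpha_1}^2}G_1(2x)=\left(\rho l+\frac{k_{\alpha_1}(U_m-U_i)}{\lambda_{\alpha_1}^2}\right)2x,$$ and $G_1,G_2$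 are the functions defined for $x>0$ by $$G_1(x)=\frac{W\left(-x,-\frac{\alpha}{2},1+\frac{\alpha}{2}\right)}{W\left(-x,-\frac{\alpha}{2},1\right)},\qquad G_2(x)=\frac{\frac{2}{\alpha}\,W\left(-x,-\frac{\alpha}{2},\frac{\alpha}{2}\right)}{1-W\left(-x,-\frac{\alpha}{2},1\right)}.$$
   Context: Wright function: for $z\in\mathbb{R}$, $\sigma>-1$, $\beta\in\mathbb{R}$, $W(z,\sigma,\beta)=\sum_{k=0}^\infty\frac{z^k}{k!\,\Gamma(\sigma k+\beta)}$. Riemann--Liouville operators in $t$: ${}_0I_t^{\alpha}u(x,t)=\frac1{\Gamma(\alpha)}\int_0^t(t-\tau)^{\alpha-1}u(x,\tau)\,d\tau$ and ${}_0^{RL}D_t^{1-\alpha}u(x,t)=\frac{\partial}{\partial t}\,{}_0I_t^{\alpha}u(x,t)$. $AC_t[0,T]$ (respectively $AC_t(0,T)$) is the set of functions $u$ such that $u(x,\cdot)$ is absolutely continuous on $[0,T]$ (respectively $(0,T)$) for every $x>0$. $C^2_x$ denotes functions that are twice continuously differentiable in $x$. Problem (P): find $w_1,w_2$ and $r$ such that (i) $\frac{\partial}{\partial t}w_2(x,t)=\lambda_{\alpha_2}^2\frac{\partial}{\partial x}\left({}_0^{RL}D_t^{1-\alpha}\left(\frac{\partial}{\partial x}w_2(x,t)\right)\right)$ for $0<x<r(t)$, $0<t<T$; (ii) $\frac{\partial}{\partial t}w_1(x,t)=\lambda_{\alpha_1}^2\frac{\partial}{\partial x}\left({}_0^{RL}D_t^{1-\alpha}\left(\frac{\partial}{\partial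 x}w_1(x,t)\right)\right)$ for $x>r(t)$, $0<t<T$; (iii) $w_1(x,0)=U_i$ for $x\ge0$; (iv) $w_2(0,t)=U_0$ for $0<t\le T$; (v) $w_1(r(t),t)=w_2(r(t),t)=U_m$ for $0<t\le T$; (vi) $\rho l\,\frac{d}{dt}r(t)=k_{\alpha_1}\lim_{x\to r(t)^+}{}_0^{RL}D_t^{1-\alpha}\frac{\partial}{\partial x}w_1(x,t)-k_{\alpha_2}\lim_{x\to r(t)^-}{}_0^{RL}D_t^{1-\alpha}\frac{\partial}{\partial x}w_2(x,t)$ for $0<t\le T$; (vii) $r(0)=0$. A triple $\{w_1,w_2,r\}$ is a solution of (P) if: (1) $w_2$ is continuous in $\{(x,t):0\le x\le r(t),\ 0<t\le T\}$ and at the point $(0,0)$ it verifies $0\le\liminf_{(x,t)\to(0,0)}w_2(x,t)\le\limsup_{(x,t)\to(0,0)}w_2(x,t)<+\infty$; (2) $w_1$ is continuous in $\{(x,t):x>r(t),\ 0<t\le T\}$ and at the point $(0,0)$ it verifies $0\le\liminf_{(x,t)\to(0,0)}w_1(x,t)\le\limsup_{(x,t)\to(0,0)}w_1(x,t)<+\infty$; (3) $w_1\in C((0,\infty)\times(0,T))\cap C^2_x((0,\infty)\times(0,T))$ with $\frac{\partial}{\partial x}w_1\in AC_t(0,T)$; (4) $w_2\in C((0,\infty)\times(0,T))\cap C^2_x((0,\infty)\times(0,T))$ with $\frac{\partial}{\partial x}w_2\in AC_t[0,T]$; (5) $r\in C^1(0,T)$; (6) the limits $\lim_{x\to r(t)^-}{}_0^{RL}D_t^{1-\alpha}\frac{\partial}{\partial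 x}w_2(x,t)$ and $\lim_{x\to r(t)^+}{}_0^{RL}D_t^{1-\alpha}\frac{\partial}{\partial x}w_1(x,t)$ exist for all $t\in(0,T]$; (7) $w_1,w_2,r$ satisfy (i)--(vii).
   Formalization: In conditions (1) and (2) the lower bound 0 on the lower limits at (0,0) is replaced by min(0,U_i): when U_i<0 the lower limit of w_1 at the origin is U_i, so the bound 0 fails; for U_i≥0 the definition is unchanged. *)

(* Defs.v *)
From mathcomp Require Import all_boot all_order all_algebra.
From mathcomp Require Import all_classical all_reals all_analysis.

Set Implicit Arguments.
Unset Strict Implicit.
Unset Printing Implicit Defensive.

Import Order.TTheory GRing.Theory Num.Theory.
Import numFieldNormedType.Exports.

Local Open Scope classical_set_scope.
Local Open Scope ring_scope.

(* Euler's integral on the positive axis, continued to [x <= 0] by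
   Gamma x = Gamma (x + n) / (x (x + 1) ... (x + n - 1)), with n such that
   0 < x + n.  At a pole one of the factors is 0, so that division by 0 = 0
   gives [(Gamma x)^-1 = 0], the value of the entire function 1 / Gamma. *)
Definition Gamma (R : realType) (x : R) : R :=
  let euler (y : R) :=
    \int[lebesgue_measure]_(s in `]0, +oo[) (s `^ (y - 1) * expR (- s)) in
  if 0 < x then euler x
  else let n := (Num.truncn (- x)).+1 in
       euler (x + n%:R) / \prod_(i < n) (x + i%:R).

Definition wright (R : realType) (z sigma beta : R) : R :=
  limn (series (fun k : nat =>
    z ^+ k / (k`!%:R * Gamma (sigma * k%:R + beta)))).

(* [W (- x / (lam t^(alpha/2)), - alpha/2, 1)]; as [t] tends to 0+ the
   similarity variable tends to -oo, and the value at [t = 0] is the limit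
   of [W] there. *)
Definition wright_sim (R : realType) (alpha lam x t : R) : R :=
  if t == 0 then lim (wright z (- (alpha / 2)) 1 @[z --> -oo])
  else wright (- (x / (lam * t `^ (alpha / 2)))) (- (alpha / 2)) 1.

Definition G1 (R : realType) (alpha x : R) : R :=
  wright (- x) (- (alpha / 2)) (1 + alpha / 2)
  / wright (- x) (- (alpha / 2)) 1.

Definition G2 (R : realType) (alpha x : R) : R :=
  2 / alpha * wright (- x) (- (alpha / 2)) (alpha / 2)
  / (1 - wright (- x) (- (alpha / 2)) 1).

(* Functions of space and time are curried, the space variable coming first. *)

Definition d_dx (R : realType) (u : R -> R -> R) (x t : R) : R :=
  derive1 (fun y => u y t) x.

Definition d_dt (R : realType) (u : R -> R -> R) (x t : R) : R :=
  derive1 (u x) t.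

Definition RL_int (R : realType) (alpha : R) (u : R -> R -> R) (x t : R) : R :=
  (Gamma alpha)^-1 *
  \int[lebesgue_measure]_(tau in `[0, t]) ((t - tau) `^ (alpha - 1) * u x tau).

(* The derivative of order [1 - alpha]. *)
Definition RL_D (R : realType) (alpha : R) (u : R -> R -> R) : R -> R -> R :=
  d_dt (RL_int alpha u).

(* [derive1] is total: an arbitrary value is returned where the derivative
   does not exist, so existence is stated separately. *)
Definition has_RL_D (R : realType) (alpha : R) (u : R -> R -> R) (x t : R) :=
  derivable (RL_int alpha u x) t 1.

Definition abs_cont (R : realType) (I : set R) (f : R -> R) : Prop :=
  forall e : R, 0 < e -> exists2 d : R, 0 < d &
  forall (n : nat) (a b : 'I_n -> R),
    (forall i, [/\ a i <= b i, I (a i) & I (b i)]) ->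
    trivIset [set: 'I_n] (fun i => [set` `]a i, b i[]) ->
    \sum_(i < n) (b i - a i) < d ->
    \sum_(i < n) `|f (b i) - f (a i)| < e.

Definition continuous_in2 (R : realType) (A : set (R * R))
    (u : R -> R -> R) : Prop :=
  {within A, continuous (fun p : R * R => u p.1 p.2)}.

Definition C2_x (R : realType) (A : set (R * R)) (u : R -> R -> R) : Prop :=
  (forall p, A p -> derivable (fun y => u y p.2) p.1 1 /\
                    derivable (fun y => d_dx u y p.2) p.1 1) /\
  (continuous_in2 A (d_dx u) /\ continuous_in2 A (d_dx (d_dx u))).

(* Lower and upper limits at (0, 0) along [A]. *)
Definition bounded_at_origin (R : realType) (m : R) (A : set (R * R))
    (u : R -> R -> R) : Prop :=
  let f (p : R * R) := (u p.1 p.2)%:E in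
  let F := within A (nbhs ((0, 0) : R * R)) in
  ((m%:E <= limf_einf f F) /\
   (limf_einf f F <= limf_esup f F) /\ (limf_esup f F < +oo))%E.

(* d/dt w = lam^2 d/dx (D (d/dx w)) at (x, t), D being the Riemann-Liouville
   derivative of order 1 - alpha, every derivative being required to exist. *)
Definition satisfies_pde (R : realType) (alpha lam : R) (w : R -> R -> R)
    (x t : R) : Prop :=
  [/\ derivable (w x) t 1,
      \forall y \near x, has_RL_D alpha (d_dx w) y t,
      derivable (fun y => RL_D alpha (d_dx w) y t) x 1
    & d_dt w x t = lam ^+ 2 * d_dx (RL_D alpha (d_dx w)) x t].

(* [m] is the lower bound asked of the lower limits of the two temperatures at
   the origin: it is the zero of the temperature scale when the data are
   nonnegative. *)
Record is_solution (R : realType)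
    (alpha T rho l lam_a1 lam_a2 k_a1 k_a2 Ui Um U0 m : R)
    (w1 w2 : R -> R -> R) (r : R -> R) : Prop := IsSolution {
  w2_continuous_phase : continuous_in2
    [set p | 0 <= p.1 <= r p.2 /\ 0 < p.2 <= T] w2;
  w2_origin : bounded_at_origin m
    [set p | 0 <= p.1 <= r p.2 /\ 0 < p.2 <= T] w2;
  w1_continuous_phase : continuous_in2
    [set p | r p.2 < p.1 /\ 0 < p.2 <= T] w1;
  w1_origin : bounded_at_origin m
    [set p | r p.2 < p.1 /\ 0 < p.2 <= T] w1;
  w1_continuous : continuous_in2 (`]0, +oo[ `*` `]0, T[) w1;
  w1_C2 : C2_x (`]0, +oo[ `*` `]0, T[) w1;
  w1_AC : forall x : R, 0 < x -> abs_cont `]0, T[ (d_dx w1 x);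
  w2_continuous : continuous_in2 (`]0, +oo[ `*` `]0, T[) w2;
  w2_C2 : C2_x (`]0, +oo[ `*` `]0, T[) w2;
  w2_AC : forall x : R, 0 < x ->
    (forall t : R, 0 <= t <= T -> derivable (fun y => w2 y t) x 1) /\
    abs_cont `[0, T] (d_dx w2 x);
  r_C1 : (forall t : R, 0 < t < T -> derivable r t 1) /\
    {within `]0, T[, continuous (derive1 r)};
  flux2_limit : forall t : R, 0 < t <= T ->
    (\forall x \near (r t)^'-, has_RL_D alpha (d_dx w2) x t) /\
    cvg (RL_D alpha (d_dx w2) x t @[x --> (r t)^'-]);
  flux1_limit : forall t : R, 0 < t <= T ->
    (\forall x \near (r t)^'+, has_RL_D alpha (d_dx w1) x t) /\
    cvg (RL_D alpha (d_dx w1) x t @[x --> (r t)^'+]);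
  pde2 : forall x t : R, 0 < x < r t -> 0 < t < T ->
    satisfies_pde alpha lam_a2 w2 x t;
  pde1 : forall x t, r t < x -> 0 < t < T ->
    satisfies_pde alpha lam_a1 w1 x t;
  w1_initial : forall x : R, 0 <= x -> w1 x 0 = Ui;
  w2_boundary : forall t : R, 0 < t <= T -> w2 0 t = U0;
  front_temperature : forall t : R, 0 < t <= T ->
    w1 (r t) t = Um /\ w2 (r t) t = Um;
  stefan_condition : forall t : R, 0 < t <= T ->
    derivable r t 1 /\
    rho * l * derive1 r t =
      k_a1 * lim (RL_D alpha (d_dx w1) x t @[x --> (r t)^'+])
      - k_a2 * lim (RL_D alpha (d_dx w2) x t @[x --> (r t)^'-]);
  r_initial : r 0 = 0
}.

(* Main.v *)
Require Import Defs.
From mathcomp Require Import all_boot all_order all_algebra.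
From mathcomp Require Import all_classical all_reals all_analysis.
From mathcomp Require Import measurable_realfun ring lra.
Set Implicit Arguments.
Unset Strict Implicit.
Unset Printing Implicit Defensive.
Import Order.TTheory GRing.Theory Num.Theory.
Import numFieldNormedType.Exports.
Local Open Scope classical_set_scope.
Local Open Scope ring_scope.

(** Put a = alpha / 2 and write W b x for W(- x, - a, b). The functions
   t ^ (b - 1) W b (xi t ^ (- a)), whose Laplace transforms in t are
   s ^ (- b) exp (- xi s ^ a), form a family which the operations of the problem
   preserve: a time derivative lowers b by 1, a space derivative lowers b by a and
   changes the sign, a fractional integral of order c raises b by c. Each
   temperature is an affine function of the member b = 1. Hence both sides of the
   heat equation are the same multiple of the member b = 0, the fluxes are
   multiples of the member b = a, and on the curve r, where xi t ^ (- a) is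
   constant, the Stefan condition is the equation for eta. What has to be proved is
   the rule for fractional integrals, the decay of W at infinity (which governs the
   initial time), and the solvability of the equation for eta.

   All of it rests on a discrete model. Let c_n (b, x) be the coefficient of w ^ n
   in (1 - w) ^ (- b) exp (- x (1 - w) ^ a), called dwright below. The
   differential equation of the exponential factor is a recurrence with
   nonnegative weights, so that c_n (b, x) >= 0 for b >= 0 and x >= 0
   ([dwright_ge0]); multiplication by (1 - w) ^ (- c) is a convolution, which is
   the fractional integral of the model ([dwrightD], from the Chu-Vandermonde
   identity). Euler's limit formula for the Gamma function ([negbin_scaled_cvg])
   and a majorant ([negbin_scaled_subfactorial]) show that n ^ (1 - b)
   c_n (b, x n ^ a) tends to W b x ([dwright_cvg]). In the limit W b >= 0 for
   b >= 0 ([wrightN_ge0]), and the convolutions, read as integrals of step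
   functions, become the rule for fractional integrals ([abel_wrightN]).

   Since - W b is the derivative of W (b + a), positivity makes W b nonincreasing
   for b >= a, and at infinity smaller than every negative power of x; the recurrence of
   1 / Gamma extends the decay to all b ([wrightN_decay]). It also implies
   0 < W 1 x < 1 for x > 0 ([wrightN1_gt0], [wrightN1_lt1]).

   Finally the recurrence gives G1 x + x = W a x / (a W 1 x). The equation for eta
   then says, with positive constants A, B and C, that
   A W a (2 lam x) / (1 - W 1 (2 lam x)) - B W a (2 x) / W 1 (2 x) equals C x. The
   first quotient decreases from infinity and the second one increases
   ([flux_ratio_nonincreasing], [flux_ratio_nondecreasing]), so that there is
   exactly one solution ([eta_exists_unique]). *)

(** * Real calculus *)

Section calculus.
Context {R : realType}.
Implicit Types (f : R -> R) (x y df : R).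

Lemma is_derive_derivable f x df : is_derive x 1 f df -> derivable f x 1.
Proof. by case. Qed.

Lemma is_derive_derive1 f x df : is_derive x 1 f df -> f^`()%classic x = df.
Proof. by case=> _ <-; rewrite derive1E. Qed.

Lemma is_derive_continuous f x df : is_derive x 1 f df -> {for x, continuous f}.
Proof. by case=> /derivable1_diffP/differentiable_continuous. Qed.

Lemma is_derive_mull (c : R) f x df :
  is_derive x 1 f df -> is_derive x 1 (fun y => c * f y) (c * df).
Proof. by move=> d; exact: (is_deriveZ c d). Qed.

Lemma derivable_LRcontinuous (F : R -> R) (u v : R) : u <= v ->
  (forall z, u <= z <= v -> derivable F z 1) -> derivable_oo_LRcontinuous F u v.
Proof.
move=> uv dF; have cF z : u <= z <= v -> {for z, continuous F}.
  by move=> /dF/derivable1_diffP; exact: differentiable_continuous.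
split.
- by move=> z; rewrite in_itv/= => /andP[? ?]; apply: dF; rewrite !ltW.
- by apply: cvg_at_right_filter; apply: cF; rewrite lexx.
- by apply: cvg_at_left_filter; apply: cF; rewrite lexx uv.
Qed.

Lemma within_itv_continuous (f : R -> R) (u v : R) :
  (forall z, u <= z <= v -> {for z, continuous f}) -> {within `[u, v], continuous f}.
Proof.
move=> cf; apply: continuous_in_subspaceT => z; rewrite inE/= in_itv/=; exact: cf.
Qed.

Lemma mean_value f (df : R -> R) x y : x <= y ->
  (forall z, x <= z <= y -> is_derive z 1 f (df z)) ->
  exists2 z, x <= z <= y & f y - f x = df z * (y - x).
Proof.
move=> xy d.
have [z||z zxy E] := @MVT_segment _ f df x y xy.
- by rewrite in_itv/= => /andP[? ?]; apply: d; rewrite !ltW.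
- apply: within_itv_continuous => z zxy; exact: is_derive_continuous (d z zxy).
- by exists z => //; rewrite in_itv/= in zxy.
Qed.

Lemma nonincreasing_of_derive f (df : R -> R) x y : x <= y ->
  (forall z, x <= z <= y -> is_derive z 1 f (df z)) ->
  (forall z, x <= z <= y -> df z <= 0) -> f y <= f x.
Proof.
move=> xy d dneg; have [z zxy E] := mean_value xy d.
by rewrite -subr_le0 E mulr_le0_ge0 ?dneg ?subr_ge0.
Qed.

Lemma near_snd_gt0 (p : R * R) : 0 < p.2 -> \forall q \near p, 0 < q.2.
Proof.
move=> p0; have h : {for p, continuous (snd : R * R -> R)} by exact: cvg_snd.
exact: cvgr_gt h _ p0.
Qed.

Lemma powR_antitone (e x y : R) : 0 < x -> x <= y -> e <= 1 ->
  y `^ (e - 1) <= x `^ (e - 1).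
Proof.
move=> x0 xy e1; have -> : e - 1 = - (1 - e) by ring.
have y0 := lt_le_trans x0 xy.
rewrite !powRN lef_pV2 ?posrE ?powR_gt0//.
by apply: ge0_ler_powR; rewrite ?subr_ge0 ?nnegrE// ltW.
Qed.

Lemma expr_fact_le (X : R) (k : nat) : 0 <= X -> X ^+ k / k`!%:R <= expR X.
Proof.
case: k => [|k] X0; first by rewrite expr0 fact0 divr1 -expR0 ler_expR.
by apply: (le_trans _ (expR_ge1Dxn k X0)); rewrite lerDr.
Qed.

End calculus.

(** * Series with a geometric majorant, exponential generating functions *)

Section dominated_series.
Context {R : realType}.
Implicit Types (f g : nat -> R) (K : R).

(** In the induction on m the bound 2 K / 2 ^ n has to be improved to the sum
   2 K / 2 ^ n - 2 K / 2 ^ (n + m) of the geometric series. *)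
Lemma geometric_tail K f : (forall k, `|f k| <= K * 2^-1 ^+ k) ->
  forall n m, `|series f (n + m)%N - series f n| <= 2 * K * 2^-1 ^+ n.
Proof.
move=> fK n m.
have K0 : 0 <= K by have := fK 0%N; rewrite expr0 mulr1; exact: le_trans.
suff : `|series f (n + m)%N - series f n| <= 2 * K * 2^-1 ^+ n - 2 * K * 2^-1 ^+ (n + m).
  by move/le_trans; apply; rewrite gerBl mulr_ge0 ?exprn_ge0// mulr_ge0.
elim: m => [|m ih]; first by rewrite addn0 !subrr normr0.
rewrite addnS seriesSr addrAC (le_trans (ler_normD _ _))//.
rewrite (le_trans (lerD ih (fK _)))// exprS; lra.
Qed.

Lemma dominated_series_is_cvg K f : (forall k, `|f k| <= K * 2^-1 ^+ k) ->
  cvgn (series f).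
Proof.
move=> fK; apply: normed_cvg; apply: (series_le_cvg _ _ fK) => //.
- by move=> k; exact: le_trans (fK k).
- by apply: is_cvg_geometric_series; rewrite ger0_norm ?invr_ge0// invf_lt1 ?ltr1n.
Qed.

Lemma dominated_series_tail K f : (forall k, `|f k| <= K * 2^-1 ^+ k) ->
  forall n, `|limn (series f) - series f n| <= 2 * K * 2^-1 ^+ n.
Proof.
move=> fK n; have cf := dominated_series_is_cvg fK.
have h : (fun m => `|series f m - series f n|) @ \oo --> `|limn (series f) - series f n|.
  by apply: cvg_norm; apply: cvgB => //; exact: cvg_cst.
rewrite -(cvg_lim _ h)//; apply: limr_le; first by apply/cvg_ex; eexists; exact: h.
by near=> m; rewrite -(@subnKC n m) ?geometric_tail//; near: m; exact: nbhs_infty_ge.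
Unshelve. all: by end_near. Qed.

(** Tannery's theorem with a geometric majorant: the tails beyond n are all at
   most 2 K / 2 ^ n, so that finitely many terms decide the limit. *)
Lemma tannery K (u : nat -> nat -> R) (v : nat -> R) :
  (forall i k, `|u i k| <= K * 2^-1 ^+ k) ->
  (forall k, u ^~ k @ \oo --> v k) ->
  (fun i => limn (series (u i))) @ \oo --> limn (series v).
Proof.
move=> uK uv.
have vK k : `|v k| <= K * 2^-1 ^+ k.
  have h : (fun i => `|u i k|) @ \oo --> `|v k| by exact: cvg_norm (uv k).
  rewrite -(cvg_lim _ h)//; apply: limr_le; first by apply/cvg_ex; eexists; exact: h.
  by near=> i.
have suv n : (fun i => series (u i) n) @ \oo --> series v n.
  rewrite /series/=; elim: n => [|n ih].
    by rewrite big_geq//; under eq_fun do rewrite big_geq//; exact: cvg_cst.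
  rewrite big_nat_recr//=; under eq_fun do rewrite big_nat_recr//=.
  by apply: cvgD.
have K0 : 0 <= K by have := vK 0%N; rewrite expr0 mulr1; exact: le_trans.
apply/cvgrPdist_le => e e0.
have [n hn] : exists n, 4 * K * 2^-1 ^+ n <= e / 2.
  have h : (fun n => 4 * K * 2^-1 ^+ n) @ \oo --> (0 : R).
    by apply: cvg_geometric; rewrite ger0_norm ?invr_ge0// invf_lt1 ?ltr1n.
  have e20 : 0 < e / 2 by rewrite divr_gt0.
  have /cvgrPdist_le/(_ _ e20)[n _ hn] := h.
  by exists n; have := hn n (leqnn n); rewrite /= sub0r normrN; exact: le_trans (ler_norm _).
have e20 : 0 < e / 2 by rewrite divr_gt0.
have /cvgrPdist_le/(_ _ e20) := suv n; apply: filterS => i hi.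
have := dominated_series_tail (uK i) n; have := dominated_series_tail vK n.
rewrite !ler_norml in hi *; move=> /andP[? ?] /andP[? ?]; move: hi => /andP[? ?].
apply/andP; split; lra.
Unshelve. all: by end_near. Qed.

End dominated_series.

Section egf.
Context {R : realType}.
Implicit Types (A C th z : R) (g : nat -> R).

(** The exponential generating function of g. Both the Wright function and its
   discrete counterpart are of this form. *)
Definition egf g z : R := limn (series (fun k => z ^+ k / k`!%:R * g k)).

(** For th < 1 this growth makes the generating function entire; it is uniform
   in a family of sequences when A, C and th are. *)
Definition subfactorial A C th g :=
  forall k, `|g k| <= A * C ^+ k * k`!%:R `^ th.

(** The terms are (Z C) ^ k / (k!) ^ (1 - th). With X ^ (1 - th) = 2 Z C they are
   (X ^ k / k!) ^ (1 - th) / 2 ^ k, and X ^ k / k! is at most exp X. *)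
Lemma subfactorial_dominated A C th Z : 0 <= A -> 0 <= C -> th < 1 -> 0 <= Z ->
  exists K, forall k, Z ^+ k / k`!%:R * (A * C ^+ k * k`!%:R `^ th) <= K * 2^-1 ^+ k.
Proof.
move=> A0 C0 th1 Z0.
have q0 : 0 < 1 - th by rewrite subr_gt0.
pose X := (2 * (Z * C)) `^ (1 - th)^-1.
have XE : X `^ (1 - th) = 2 * (Z * C).
  by rewrite /X -powRrM mulVf ?gt_eqF// powRr1// mulr_ge0// mulr_ge0.
exists (A * expR X `^ (1 - th)) => k.
have f0 : 0 < k`!%:R :> R by rewrite ltr0n fact_gt0.
have -> : Z ^+ k / k`!%:R * (A * C ^+ k * k`!%:R `^ th) =
          A * ((Z * C) ^+ k / k`!%:R `^ (1 - th)).
  rewrite exprMn powRB ?gt_eqF ?implybT// powRr1 ?ltW//.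
  have : k`!%:R `^ th != 0 :> R by rewrite gt_eqF// powR_gt0.
  by move=> ?; field; apply/andP; split => //; rewrite gt_eqF.
rewrite -mulrA ler_wpM2l//.
have -> : (Z * C) ^+ k = (X ^+ k) `^ (1 - th) * 2^-1 ^+ k.
  rewrite -powR_mulrn ?powR_ge0// powRAC XE powR_mulrn; last by rewrite !mulr_ge0.
  by rewrite -exprMn; congr (_ ^+ k); field.
rewrite mulrAC ler_wpM2r ?exprn_ge0//.
rewrite ler_pdivrMr ?powR_gt0// -powRM ?expR_ge0//.
rewrite ge0_ler_powR// ?nnegrE ?exprn_ge0 ?powR_ge0 ?mulr_ge0 ?expR_ge0 ?(ltW q0) ?(ltW f0)//.
by rewrite -ler_pdivrMr// expr_fact_le// powR_ge0.
Qed.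

Lemma egf_term_dominated A C th Z : 0 <= A -> 0 <= C -> th < 1 -> 0 <= Z ->
  exists K, forall g z, subfactorial A C th g -> `|z| <= Z ->
    forall k, `|z ^+ k / k`!%:R * g k| <= K * 2^-1 ^+ k.
Proof.
move=> A0 C0 th1 Z0; have [K hK] := subfactorial_dominated A0 C0 th1 Z0.
exists K => g z gA zZ k; apply: (le_trans _ (hK k)).
rewrite !normrM normrX normfV normr_nat ler_pM//.
by rewrite ler_pM2r ?invr_gt0 ?ltr0n ?fact_gt0// lerXn2r// nnegrE.
Qed.

Variables (A C th : R).
Hypotheses (A0 : 0 <= A) (C0 : 0 <= C) (th1 : th < 1).

Lemma egf_cvg g z : subfactorial A C th g ->
  cvgn (series (fun k => z ^+ k / k`!%:R * g k)).
Proof.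
move=> gA; have [K hK] := egf_term_dominated A0 C0 th1 (normr_ge0 z).
exact: dominated_series_is_cvg (hK g z gA (lexx _)).
Qed.

Lemma egf0 g : egf g 0 = g 0%N.
Proof.
apply: cvg_lim => //; rewrite -cvg_shiftS/=; apply: cvg_near_cst; apply: nearW => n.
rewrite /series/= big_nat_recl//= expr0 fact0 divr1 mul1r big1 ?addr0// => i _.
by rewrite expr0n/= !mul0r.
Qed.

(** The coefficients and the point may vary together: this is how every discrete
   quantity below is passed to its continuous limit. *)
Lemma egf_cvg_seq (G : nat -> nat -> R) g (Z : nat -> R) z :
  (forall i, subfactorial A C th (G i)) ->
  (forall k, G ^~ k @ \oo --> g k) -> Z @ \oo --> z ->
  (fun i => egf (G i) (Z i)) @ \oo --> egf g z.
Proof.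
move=> GA Gg Zz.
have [B hB] : exists B, forall i, `|Z i| <= B.
  have /cvg_seq_bounded[B [_ hB]] : cvgn Z by apply/cvg_ex; exists z.
  by exists (B + 1) => i; apply: (hB (B + 1)) => //; rewrite ltrDl.
have B0 : 0 <= B by exact: le_trans (hB 0%N).
have [K hK] := egf_term_dominated A0 C0 th1 B0.
apply: (@tannery _ K) => [i k|k]; first exact: hK.
apply: cvgM (Gg k); apply: cvgM; last exact: cvg_cst.
exact: (cvg_comp _ _ Zz (@exprn_continuous _ k z)).
Qed.

Lemma subfactorial_lim (G : nat -> nat -> R) g :
  (forall i, subfactorial A C th (G i)) ->
  (forall k, G ^~ k @ \oo --> g k) -> subfactorial A C th g.
Proof.
move=> GA Gg k.
have h : (fun i => `|G i k|) @ \oo --> `|g k| by exact: cvg_norm (Gg k).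
rewrite -(cvg_lim _ h)//; apply: limr_le; first by apply/cvg_ex; eexists; exact: h.
by near=> i; exact: GA.
Unshelve. all: by end_near. Qed.

End egf.

Section egf_derive.
Context {R : realType}.
Implicit Types (A C th z : R) (g : nat -> R).

Lemma subfactorial_shift A C th g : 0 <= A -> 0 <= C -> th < 1 ->
  subfactorial A C th g ->
  subfactorial (A * C) (2 * C) th (fun k => g k.+1).
Proof.
move=> A0 C0 th1 gA k; apply: le_trans (gA k.+1) _.
rewrite factS natrM powRM// exprMn exprS -!mulrA ler_wpM2l// ler_wpM2l//.
rewrite [leRHS]mulrCA ler_wpM2l ?exprn_ge0//.
rewrite ler_wpM2r ?powR_ge0//.
apply: (@le_trans _ _ k.+1%:R).
  by rewrite -[leRHS]powRr1// ler_powR ?ler1n// ltW.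
by rewrite -natrX ler_nat ltn_expl.
Qed.

Lemma is_derive_egf A C th g z : 0 <= A -> 0 <= C -> th < 1 ->
  subfactorial A C th g ->
  is_derive z 1 (egf g) (egf (fun k => g k.+1) z).
Proof.
move=> A0 C0 th1 gA.
pose c h := fun k => (h k / k`!%:R : R).
have pE h x : pseries (c h) x = series (fun k => x ^+ k / k`!%:R * h k).
  by rewrite /pseries; congr series; apply/funext => k; rewrite /c/=; ring.
have dE h : pseries_diffs (c h) = c (fun k => h k.+1).
  apply/funext => k; rewrite /pseries_diffs /c factS natrM invfM mulrCA mulVKf // pnatr_eq0.
have gA1 := subfactorial_shift A0 C0 th1 gA.
have AC0 : 0 <= A * C by rewrite mulr_ge0.
have C20 : 0 <= 2 * C by rewrite mulr_ge0.
have gA2 := subfactorial_shift AC0 C20 th1 gA1.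
have := @pseries_snd_diffs R (c g) (`|z| + 1) z; rewrite !dE !pE.
have -> : (fun x => limn (pseries (c g) x)) = egf g by apply/funext => x; rewrite pE.
apply.
- exact: egf_cvg gA.
- exact: egf_cvg gA1.
- by apply: egf_cvg gA2; rewrite ?mulr_ge0.
- by rewrite [ltRHS]ger0_norm ?addr_ge0// ltrDl.
Qed.

End egf_derive.

(** * Euler's integral *)

Section gamma.
Context {R : realType}.
Notation mu := (@lebesgue_measure R).
Implicit Types x y th s : R.

Definition euler_integrand x s : R := s `^ (x - 1) * expR (- s).

Definition euler_integral x : \bar R :=
  (\int[mu]_(s in `]0%R, +oo[) (euler_integrand x s)%:E)%E.

Lemma euler_integrand_ge0 x s : 0 <= euler_integrand x s.
Proof. by rewrite mulr_ge0 ?powR_ge0 ?expR_ge0. Qed.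

Lemma euler_integral_ge0 x : (0 <= euler_integral x)%E.
Proof. by apply: integral_ge0 => s _; rewrite lee_fin euler_integrand_ge0. Qed.

Lemma measurable_euler_integrand x D : measurable_fun D (euler_integrand x).
Proof.
apply: measurable_funTS; apply: measurable_funM; first exact: measurable_powR.
by apply: measurableT_comp => //; exact: measurable_funN.
Qed.

Lemma Gamma_pos x : 0 < x -> Gamma x = fine (euler_integral x).
Proof. by rewrite /Gamma => ->. Qed.

Lemma is_derive_expRN s : is_derive s 1 (fun s => - expR (- s)) (expR (- s)).
Proof.
have h : is_derive s 1 (fun s : R => - s) (- 1) by exact: is_deriveN.
have h2 := is_derive1_comp (is_derive_expR (- s)) h.
by apply: is_derive_eq (is_deriveN h2) _; rewrite /GRing.scale/= mulrN1 opprK.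
Qed.

Lemma euler_integral1 : euler_integral 1 = 1%E.
Proof.
rewrite /euler_integral integral_itv_obnd_cbnd; last first.
  by apply/measurable_EFinP; exact: measurable_euler_integrand.
have -> : (\int[mu]_(s in `[0%R, +oo[) (euler_integrand 1 s)%:E =
           \int[mu]_(s in `[0%R, +oo[) (expR (- s))%:E)%E.
  by apply: eq_integral => s _; rewrite /euler_integrand subrr powRr0 mul1r.
have cN s : {for s, continuous (fun s : R => expR (- s))}.
  by apply: continuous_comp; [exact: opp_continuous|exact: continuous_expR].
rewrite (@ge0_continuous_FTC2y R (fun s => expR (- s)) (fun s => - expR (- s)) 0 0).
- by rewrite oppr0 expR0 sub0e EFinN oppeK.
- by move=> s _; rewrite expR_ge0.
- exact: continuous_subspaceT.
- by rewrite -oppr0; apply: cvgN; exact: cvgr_expR.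
- by move=> s _; exact: is_derive_derivable (is_derive_expRN s).
- by apply: cvg_at_right_filter; apply: cvgN; exact: cN.
- by move=> s _; apply: is_derive_derive1; exact: is_derive_expRN.
Qed.

Definition euler_truncated x (u v : R) : \bar R :=
  (\int[mu]_(s in `[u, v]) (euler_integrand x s)%:E)%E.

(** The intervals from 1 / (i + 1) to i + 1 increase to the half-line, and the
   integrand is nonnegative. *)
Lemma euler_exhaustion x :
  euler_truncated x i.+1%:R^-1 i.+1%:R @[i --> \oo] --> euler_integral x.
Proof.
pose F (i : nat) := `[i.+1%:R^-1, i.+1%:R : R]%classic.
have UF : \bigcup_i F i = `]0, +oo[%classic.
  apply/seteqP; split => s /=.
    move=> [i _]; rewrite /F/= !in_itv/= => /andP[h _].
    by rewrite andbT (lt_le_trans _ h)// invr_gt0.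
  rewrite in_itv/= andbT => s0.
  exists (maxn (Num.truncn s) (Num.truncn s^-1)) => //; rewrite /F/= in_itv/=; apply/andP; split.
    rewrite -[leRHS]invrK lef_pV2 ?posrE ?invr_gt0//.
    by rewrite (le_trans (ltW (truncnS_gt _)))// ler_nat ltnS leq_maxr.
  by rewrite (le_trans (ltW (truncnS_gt _)))// ler_nat ltnS leq_maxl.
rewrite /euler_integral -UF.
apply: ge0_nondecreasing_set_cvg_integral.
- apply/nondecreasing_seqP => i; rewrite subsetEset => s; rewrite /F/= !in_itv/=.
  move=> /andP[h1 h2]; apply/andP; split.
    by apply: (le_trans _ h1); rewrite lef_pV2 ?posrE// ler_nat.
  by apply: (le_trans h2); rewrite ler_nat.
- by move=> i; exact: measurable_itv.
- by move=> i; apply/measurable_EFinP; exact: measurable_euler_integrand.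
- by move=> i s _; rewrite lee_fin euler_integrand_ge0.
Qed.

(** Integration by parts; the truncation to a compact interval avoids both
   singular ends, which are reached by monotone convergence. *)
Lemma euler_by_parts x (u v : R) : 0 < x -> 0 < u -> u < v ->
  (euler_truncated (x + 1) u v =
   (u `^ x * expR (- u) - v `^ x * expR (- v))%:E + x%:E * euler_truncated x u v)%E.
Proof.
move=> x0 u0 uv; rewrite /euler_truncated.
have gt0 z : u <= z <= v -> 0 < z by move=> /andP[h _]; exact: lt_le_trans h.
have dp (z : R) : 0 < z -> is_derive z 1 (fun s => s `^ x) (x * z `^ (x - 1)).
  exact: is_derive1_powR.
have := @integration_by_parts R (fun s => s `^ x) (fun s => - expR (- s))
  (fun s => x * s `^ (x - 1)) (fun s => expR (- s)) u v uv.
have -> : (\int[mu]_(s in `[u, v]) (s `^ x * expR (- s))%:E =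
    \int[mu]_(s in `[u, v]) (euler_integrand (x + 1) s)%:E)%E.
  by apply: eq_integral => s _; rewrite /euler_integrand addrK.
move=> ->.
- have -> : (\int[mu]_(s in `[u, v]) (x * s `^ (x - 1) * - expR (- s))%:E =
      - (x%:E * \int[mu]_(s in `[u, v]) (euler_integrand x s)%:E))%E.
    rewrite -ge0_integralZl//; last 3 first.
    + by apply/measurable_EFinP; exact: measurable_euler_integrand.
    + by move=> s _; rewrite lee_fin euler_integrand_ge0.
    + by rewrite lee_fin ltW.
    rewrite -integral_ge0N; last first.
      by move=> s _; apply: mule_ge0; rewrite lee_fin ?euler_integrand_ge0// ltW.
    by apply: eq_integral => s _; rewrite -EFinM -EFinN mulrN mulrA.
  by rewrite oppeK; congr (_ + _)%E; congr (_%:E); ring.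
- apply: within_itv_continuous => z /gt0 z0; apply: continuousM; first exact: cst_continuous.
  exact: is_derive_continuous (is_derive1_powR _ z0).
- by apply: derivable_LRcontinuous; [exact: ltW|move=> z /gt0/dp[]].
- move=> z; rewrite in_itv/= => /andP[uz zv]; 
  by apply: is_derive_derive1; apply: dp; exact: lt_trans uz.
- apply: within_itv_continuous => z _.
  by apply: continuous_comp; [exact: opp_continuous|exact: continuous_expR].
- by apply: derivable_LRcontinuous; [exact: ltW|move=> z _; case: (is_derive_expRN z)].
- by move=> z _; apply: is_derive_derive1; exact: is_derive_expRN.
Qed.

End gamma.

Section gamma_rec.
Context {R : realType}.
Notation mu := (@lebesgue_measure R).
Implicit Types x y th s : R.

Lemma powR_expRN_cvg0 x : (i.+1%:R `^ x * expR (- i.+1%:R) : R) @[i --> \oo] --> (0 : R).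
Proof.
pose m := (Num.truncn x).+1.
have hx : x <= m%:R by exact: ltW (truncnS_gt _).
apply: (@squeeze_cvgr _ _ _ _ (fun=> 0) (fun i => m.+1`!%:R * i.+1%:R^-1)); last first.
- by rewrite -[X in _ --> X](mulr0 m.+1`!%:R); apply: cvgM; [exact: cvg_cst|exact: cvg_harmonic].
- exact: cvg_cst.
apply: nearW => i; rewrite mulr_ge0 ?powR_ge0 ?expR_ge0//=.
have i0 : 0 < i.+1%:R :> R by rewrite ltr0n.
rewrite expRN ler_pdivrMr ?expR_gt0//.
apply: (@le_trans _ _ (i.+1%:R ^+ m)).
  by rewrite -powR_mulrn// ler_powR// ler1n.
have := @expr_fact_le R i.+1%:R m.+1 (ltW i0).
rewrite ler_pdivrMr ?ltr0n ?fact_gt0// exprSr mulrAC => h.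
rewrite ler_pdivlMr//.
by rewrite [leRHS]mulrC.
Qed.

(** An identity between extended reals: finiteness for x < 1 is deduced from it. *)
Lemma euler_integral_rec x : 0 < x -> euler_integral (x + 1) = (x%:E * euler_integral x)%E.
Proof.
move=> x0.
have h1 := @euler_exhaustion R (x + 1).
have h2 : (x%:E * euler_truncated x i.+1%:R^-1 i.+1%:R)%E @[i --> \oo] -->
    (x%:E * euler_integral x)%E.
  by apply: cvgeZl => //; exact: euler_exhaustion.
pose bd (i : nat) := i.+1%:R^-1 `^ x * expR (- i.+1%:R^-1) - i.+1%:R `^ x * expR (- i.+1%:R) : R.
have h3 : bd @ \oo --> (0 : R).
  rewrite -(subr0 0); apply: cvgB; last exact: powR_expRN_cvg0.
  have h : (fun i : nat => i.+1%:R^-1 `^ x : R) @ \oo --> (0 : R).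
    have /cvg_at_rightP := @powR_cvg0 R x x0; apply; split; last exact: cvg_harmonic.
    by move=> n; rewrite invr_gt0.
  apply: (squeeze_cvgr _ (cvg_cst 0) h); apply: nearW => i.
  rewrite mulr_ge0 ?powR_ge0 ?expR_ge0//=.
  by rewrite ler_piMr ?powR_ge0// expR_le1 oppr_le0 invr_ge0.
have h4 : ((bd i)%:E + x%:E * euler_truncated x i.+1%:R^-1 i.+1%:R)%E @[i --> \oo]
    --> (0%:E + x%:E * euler_integral x)%E.
  by apply: cvgeD h2 => //; apply: cvg_EFin => //; exact: nearW.
rewrite add0e in h4.
apply: cvg_unique h1 _ => //.
apply: cvg_trans h4; apply: near_eq_cvg; near=> i.
have i1 : (1 <= i)%N by near: i; exact: nbhs_infty_ge.
rewrite -euler_by_parts// ?invr_gt0//.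
apply: (@lt_trans _ _ 1); first by rewrite invf_lt1// ltr1n.
by rewrite ltr1n.
Unshelve. all: by end_near. Qed.

(** For x at least 1 the integrand is dominated by the sum of those of exponents
   1 and an integer, where the recurrence starts from 1; then one step down. *)
Lemma euler_integral_fin x : 0 < x -> euler_integral x \is a fin_num.
Proof.
have hn n : euler_integral (n.+1%:R : R) \is a fin_num.
  elim: n => [|n ih]; first by rewrite euler_integral1.
  have -> : n.+2%:R = n.+1%:R + 1 :> R by rewrite natr1.
  by rewrite euler_integral_rec// fin_numM.
have h1 x0 : 1 <= x0 -> euler_integral x0 \is a fin_num.
  move=> x01; rewrite ge0_fin_numE ?euler_integral_ge0//.
  pose m := (Num.truncn x0).+1.
  have hm : x0 < m%:R by exact: truncnS_gt.
  apply: (@le_lt_trans _ _ (euler_integral 1 + euler_integral m%:R)%E); last first.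
    by rewrite lte_add_pinfty// -ge0_fin_numE ?euler_integral_ge0// (hn 0%N, hn m.-1).
  rewrite -ge0_integralD//; first last.
  - by apply/measurable_EFinP; exact: measurable_euler_integrand.
  - by move=> s _; rewrite lee_fin euler_integrand_ge0.
  - by apply/measurable_EFinP; exact: measurable_euler_integrand.
  - by move=> s _; rewrite lee_fin euler_integrand_ge0.
  apply: ge0_le_integral => //.
  - by move=> s _; rewrite lee_fin euler_integrand_ge0.
  - by apply/measurable_EFinP; exact: measurable_euler_integrand.
  - by apply: emeasurable_funD; apply/measurable_EFinP; exact: measurable_euler_integrand.
  move=> s; rewrite /= in_itv/= andbT => s0; rewrite -EFinD lee_fin /euler_integrand -mulrDl.
  rewrite ler_wpM2r ?expR_ge0// subrr powRr0.
  have [s1|s1] := leP s 1.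
    apply: (@le_trans _ _ 1); last by rewrite lerDl powR_ge0.
    by rewrite -[leRHS](powRr0 s) ger_powR ?s0 ?subr_ge0.
  rewrite -[leLHS]add0r lerD// ler_powR ?(ltW s1)// lerD2r; exact: ltW.
move=> x0; have : (x%:E * euler_integral x)%E \is a fin_num.
  by rewrite -euler_integral_rec// h1// lerDr ltW.
have := euler_integral_ge0 x; case: (euler_integral x) => // _.
by rewrite gt0_muley ?lte_fin.
Qed.

Lemma euler_integrable x : 0 < x ->
  mu.-integrable `]0, +oo[ (EFin \o euler_integrand x).
Proof.
move=> x0; apply/integrableP; split.
  by apply/measurable_EFinP; exact: measurable_euler_integrand.
have -> : (\int[mu]_(s in `]0%R, +oo[) `|(EFin \o euler_integrand x) s| = euler_integral x)%E.
  by apply: eq_integral => s _ /=; rewrite ger0_norm ?euler_integrand_ge0.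
by rewrite -ge0_fin_numE ?euler_integral_ge0// euler_integral_fin.
Qed.

Lemma Gamma1 : Gamma 1 = 1 :> R.
Proof. by rewrite Gamma_pos// euler_integral1. Qed.

Lemma Gamma_rec_pos x : 0 < x -> Gamma (x + 1) = x * Gamma x.
Proof.
move=> x0; rewrite !Gamma_pos ?addr_gt0//.
by rewrite euler_integral_rec// fineM// euler_integral_fin.
Qed.

Lemma Gamma_Rintegral x : 0 < x ->
  Gamma x = \int[mu]_(s in `]0, +oo[) euler_integrand x s.
Proof. by rewrite /Gamma => ->. Qed.

Lemma EFin_integrableZl (D : set R) (f : R -> R) c : measurable D ->
  mu.-integrable D (EFin \o f) -> mu.-integrable D (EFin \o (fun s => c * f s)).
Proof. by move=> mD fi; exact: (@integrableZl _ _ _ mu _ _ c _ fi). Qed.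

Lemma EFin_integrableD (D : set R) (f g : R -> R) : measurable D ->
  mu.-integrable D (EFin \o f) -> mu.-integrable D (EFin \o g) ->
  mu.-integrable D (EFin \o (fun s => f s + g s)).
Proof.
move=> mD fi gi; exact: (@integrableD _ _ _ mu D mD _ _ fi gi).
Qed.

(** Concavity of u ^ th at u = 1. With u = exp L, and after division by u ^ th,
   it is the combination with weights 1 - th and th of the bounds 1 + y <= exp y
   at y = - th L and y = (1 - th) L. *)
Lemma powR_le_tangent (u th : R) : 0 < u -> 0 <= th <= 1 -> u `^ th <= 1 - th + th * u.
Proof.
move=> u0 /andP[th0 th1]; rewrite /powR gt_eqF//.
have h1 := expR_ge1Dx ((1 - th) * ln u); have h2 := expR_ge1Dx (- (th * ln u)).
have e0 := expR_ge0 (th * ln u).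
have E1 : u = expR (th * ln u) * expR ((1 - th) * ln u).
  by rewrite -expRD -mulrDl addrC subrK mul1r lnK// posrE.
have E2 : 1 = expR (th * ln u) * expR (- (th * ln u)) by rewrite -expRD subrr expR0.
set E := expR (th * ln u) in e0 E1 E2 *.
set A := expR _ in h1 E1; set B := expR _ in h2 E2.
have th' : 0 <= 1 - th by lra.
have -> : 1 - th + th * u = (1 - th) * (E * B) + th * (E * A) by rewrite -E1 -E2 mulr1.
rewrite -subr_ge0.
have -> : (1 - th) * (E * B) + th * (E * A) - E =
   E * ((1 - th) * (B - (1 - th * ln u)) + th * (A - (1 + (1 - th) * ln u))) by ring.
by rewrite mulr_ge0// addr_ge0// mulr_ge0// subr_ge0.
Qed.

(** Wendel's inequality: s ^ th is bounded by its tangent at s = x, which is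
   integrated against Euler's integrand. *)
Lemma Gamma_le_powR x th : 0 < x -> 0 <= th <= 1 ->
  Gamma (x + th) <= x `^ th * Gamma x.
Proof.
move=> x0 th01; have /andP[th0 th1] := th01.
have E : x `^ th * Gamma x = x `^ th * ((1 - th) * Gamma x + th / x * Gamma (x + 1)).
  by congr (_ * _); rewrite Gamma_rec_pos// mulrA divfK ?gt_eqF//; ring.
have xt0 : 0 < x + th by rewrite ltr_pwDl.
have x10 : 0 < x + 1 by rewrite addr_gt0.
rewrite {}E !Gamma_Rintegral//.
have ix := euler_integrable x0.
have ix1 : mu.-integrable `]0, +oo[ (EFin \o euler_integrand (x + 1)).
  exact: euler_integrable.
have iZ (f : R -> R) c := @EFin_integrableZl `]0, +oo[ f c (measurable_itv _).
have iD : mu.-integrable `]0, +oo[ (EFin \o (fun s =>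
    (1 - th) * euler_integrand x s + th / x * euler_integrand (x + 1) s)).
  by apply: EFin_integrableD => //; exact: iZ.
rewrite -!RintegralZl// -RintegralD//; [|exact: iZ|exact: iZ].
rewrite -RintegralZl//.
apply: le_Rintegral => //; [|exact: iZ|].
  exact: euler_integrable.
move=> s; rewrite /= in_itv/= andbT => s0.
rewrite /euler_integrand.
have e0 := expR_ge0 (- s).
have -> : s `^ (x + th - 1) = s `^ (x - 1) * s `^ th.
  by rewrite -powRD ?(gt_eqF s0) ?implybT//; congr (_ `^ _); ring.
have -> : s `^ (x + 1 - 1) = s `^ (x - 1) * s.
  rewrite -[X in _ * X](powRr1 (ltW s0)) -powRD ?(gt_eqF s0) ?implybT//.
  by congr (_ `^ _); ring.
have h := powR_le_tangent (divr_gt0 s0 x0) th01.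
have -> : s `^ th = x `^ th * (s / x) `^ th.
  by rewrite -powRM ?ltW// ?divr_gt0// mulrC divfK ?gt_eqF.
have p0 := powR_ge0 s (x - 1); have q0 := powR_ge0 x th.
rewrite -subr_ge0.
set U := (s / x) `^ th in h *.
have -> : x `^ th * ((1 - th) * (s `^ (x - 1) * expR (- s)) +
      th / x * (s `^ (x - 1) * s * expR (- s))) -
    s `^ (x - 1) * (x `^ th * U) * expR (- s) =
    x `^ th * (s `^ (x - 1) * expR (- s) * (1 - th + th * (s / x) - U)) by ring.
by rewrite !mulr_ge0// subr_ge0.
Qed.

(** Wendel's inequality from x up to the next integer n + 1, where Gamma is n!. *)
Lemma Gamma_gt0 x : 0 < x -> 0 < Gamma x.
Proof.
move=> x0.
have hn n : 0 < Gamma (n.+1%:R : R).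
  elim: n => [|n ih]; first by rewrite Gamma1.
  have -> : n.+2%:R = n.+1%:R + 1 :> R by rewrite natr1.
  by rewrite Gamma_rec_pos// mulr_gt0.
have h : 0 <= (Num.truncn x).+1%:R - x <= 1.
  have /andP[h1 h2] := truncn_itv (ltW x0).
  by apply/andP; split; rewrite -?natr1 in h1 h2 *; lra.
have := Gamma_le_powR x0 h; rewrite addrC subrK => /(lt_le_trans (hn _)).
by rewrite pmulr_rgt0// powR_gt0.
Qed.

(** Wendel's inequality for each of the n steps of length a. *)
Lemma Gamma_natS_le_fact a n : 0 <= a <= 1 -> Gamma (1 + n%:R * a) <= n`!%:R `^ a :> R.
Proof.
move=> a01; have /andP[a0 a1] := a01; elim: n => [|n ih].
  by rewrite mul0r addr0 Gamma1 fact0 powR1.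
have p0 : 0 < 1 + n%:R * a by rewrite ltr_pwDl// mulr_ge0.
rewrite -natr1 mulrDl mul1r addrA (le_trans (Gamma_le_powR p0 a01))//.
rewrite factS natrM powRM// ler_pM ?powR_ge0 ?(ltW (Gamma_gt0 p0))//.
rewrite ge0_ler_powR ?nnegrE ?(ltW p0)// -natr1 addrC lerD2r.
by rewrite ler_piMr.
Qed.

End gamma_rec.

(** * The reciprocal Gamma function and Euler's limit formula *)

Section rgamma.
Context {R : realType}.
Implicit Types x s th : R.

Definition rgamma x : R := (Gamma x)^-1.

Lemma truncnNS_gt x : 0 < x + (Num.truncn (- x)).+1%:R.
Proof. by have := truncnS_gt (- x); rewrite -(ltrD2l x) subrr. Qed.

Lemma rgamma_rec_pos x : 0 < x -> rgamma x = x * rgamma (x + 1).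
Proof.
by move=> x0; rewrite /rgamma Gamma_rec_pos// invfM mulrA divff ?mul1r// gt_eqF.
Qed.

Lemma rgamma_gt0 x : 0 < x -> 0 < rgamma x.
Proof. by move=> x0; rewrite invr_gt0 Gamma_gt0. Qed.

Lemma rgammaE_nonpos x : x <= 0 -> let n := (Num.truncn (- x)).+1 in
  rgamma x = \prod_(i < n) (x + i%:R) * rgamma (x + n%:R).
Proof.
move=> x0 n; have xn : 0 < x + n%:R.
  exact: truncnNS_gt.
by rewrite /rgamma (Gamma_pos xn) /Gamma ltNge x0/= invfM invrK mulrC.
Qed.

(** The right-hand side does not depend on n, and the continuation to x <= 0 uses
   the smallest admissible n. *)
Lemma rgamma_shift x n : 0 < x + n%:R ->
  rgamma x = \prod_(i < n) (x + i%:R) * rgamma (x + n%:R).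
Proof.
have step m : 0 < x + m%:R ->
    \prod_(i < m) (x + i%:R) * rgamma (x + m%:R) =
    \prod_(i < m.+1) (x + i%:R) * rgamma (x + m.+1%:R).
  by move=> xm; rewrite big_ord_recr/= -mulrA rgamma_rec_pos// -addrA natr1.
have steps m k : 0 < x + m%:R ->
    \prod_(i < m) (x + i%:R) * rgamma (x + m%:R) =
    \prod_(i < m + k) (x + i%:R) * rgamma (x + (m + k)%:R).
  move=> xm; elim: k => [|k ih]; first by rewrite addn0.
  by rewrite ih step ?addnS// (lt_le_trans xm)// lerD2l ler_nat leq_addr.
have [x0|x0] := ltP 0 x.
  by move=> _; have := steps 0%N n; rewrite addr0 big_ord0 mul1r; apply.
move=> xn; rewrite (rgammaE_nonpos x0).
have h : ((Num.truncn (- x)).+1 <= n)%N.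
  by rewrite truncn_lt_nat ?oppr_ge0// -subr_gt0 opprK addrC.
rewrite -(subnKC h) -steps//.
exact: truncnNS_gt.
Qed.

Lemma rgamma_rec x : rgamma x = x * rgamma (x + 1).
Proof.
pose n := (Num.truncn (- x)).+1.
have xn : 0 < x + n%:R by exact: truncnNS_gt.
have E : x + n.+1%:R = x + 1 + n%:R by rewrite -addrA nat1r.
rewrite (@rgamma_shift x n.+1); last by rewrite E addrAC addr_gt0.
rewrite (@rgamma_shift (x + 1) n); last by rewrite addrAC addr_gt0.
rewrite big_ord_recl addr0 E -mulrA; congr (_ * (_ * _)).
by apply: eq_bigr => i _; rewrite -addrA nat1r.
Qed.

Lemma rgamma1 : rgamma 1 = 1.
Proof. by rewrite /rgamma Gamma1 invr1. Qed.

End rgamma.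

Section negbin.
Context {R : realType}.
Implicit Types (s u th : R) (m n : nat).

(** The coefficient of w ^ n in (1 - w) ^ (- s). *)
Definition negbin s n : R := \prod_(j < n) ((s + j%:R) / j.+1%:R).

Lemma negbin0 s : negbin s 0 = 1.
Proof. by rewrite /negbin big_ord0. Qed.

Lemma negbinSr s n : negbin s n.+1 = negbin s n * ((s + n%:R) / n.+1%:R).
Proof. by rewrite /negbin big_ord_recr. Qed.

Lemma negbinS s n : n.+1%:R * negbin s n.+1 = (s + n%:R) * negbin s n.
Proof. by rewrite negbinSr mulrC -mulrA divfK ?pnatr_eq0// mulrC. Qed.

Lemma negbinD1 s n : (s + n%:R) * negbin s n = s * negbin (s + 1) n.
Proof.
elim: n => [|n ih]; first by rewrite !negbin0 addr0.
rewrite !negbinSr.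
have -> : (s + n.+1%:R) * (negbin s n * ((s + n%:R) / n.+1%:R)) =
  ((s + n%:R) * negbin s n) * ((s + n.+1%:R) / n.+1%:R) by ring.
by rewrite ih -mulrA -[in RHS]addrA nat1r.
Qed.

Lemma negbinS_shift s n : n.+1%:R * negbin s n.+1 = s * negbin (s + 1) n.
Proof. by rewrite negbinS negbinD1. Qed.

Lemma negbin_ge0 s n : 0 <= s -> 0 <= negbin s n.
Proof. by move=> s0; apply: prodr_ge0 => j _; rewrite divr_ge0// addr_ge0. Qed.

(** The Chu-Vandermonde identity, (1 - w) ^ (- s) (1 - w) ^ (- u) =
   (1 - w) ^ (- (s + u)). Splitting the factor n + 1 as j + (n + 1 - j) inside
   the sum and using [negbinS] on both factors gives the induction. *)
Lemma negbinD s u n :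
  \sum_(j < n.+1) negbin u (n - j)%N * negbin s j = negbin (s + u) n.
Proof.
elim: n => [|n ih]; first by rewrite big_ord_recl big_ord0 !negbin0 mulr1 addr0.
apply: (@mulfI _ n.+1%:R); first by rewrite pnatr_eq0.
rewrite negbinS -ih.
have -> : n.+1%:R * \sum_(j < n.+2) negbin u (n.+1 - j) * negbin s j =
    \sum_(j < n.+2) (negbin u (n.+1 - j) * (j%:R * negbin s j)) +
    \sum_(j < n.+2) ((n.+1 - j)%:R * negbin u (n.+1 - j) * negbin s j).
  rewrite big_distrr -big_split/=; apply: eq_bigr => j _.
  have jn : (j <= n.+1)%N by rewrite -ltnS.
  by rewrite (natrB _ jn); ring.
rewrite big_ord_recl mul0r mulr0 add0r.
rewrite [X in _ + X]big_ord_recr/= subnn !mul0r addr0 -big_split/= big_distrr/=.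
apply: eq_bigr => j _; rewrite /bump/= add1n subSS.
have jn : (j <= n)%N by rewrite -ltnS.
by rewrite negbinS subSn// negbinS (natrB _ jn); ring.
Qed.

Lemma rgamma_negbin s n : 0 < s + n%:R ->
  negbin s n * Gamma n.+1%:R = rgamma s * Gamma (s + n%:R).
Proof.
move=> sn.
rewrite (rgamma_shift sn) -mulrA /rgamma mulVf ?mulr1 ?gt_eqF ?Gamma_gt0//.
elim: {sn}n => [|n ih]; first by rewrite negbin0 mul1r Gamma1 big_ord0.
rewrite negbinSr big_ord_recr/= -ih.
have -> : n.+2%:R = n.+1%:R + 1 :> R by rewrite natr1.
rewrite Gamma_rec_pos//.
have n0 : n.+1%:R != 0 :> R by rewrite pnatr_eq0.
by move: n.+1%:R n0 => c c0; field.
Qed.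

(** The normalization under which the coefficients converge to 1 / Gamma s. *)
Definition negbin_scaled s n : R := n.+1%:R `^ (1 - s) * negbin s n.

Lemma negbin_unscale u m : negbin u m = m.+1%:R `^ (u - 1) * negbin_scaled u m.
Proof.
have m0 : m.+1%:R != 0 :> R by rewrite pnatr_eq0.
rewrite /negbin_scaled mulrA -powRD ?m0 ?implybT//.
have -> : u - 1 + (1 - u) = 0 by ring.
by rewrite powRr0 mul1r.
Qed.

Lemma negbin_scaled_shift s n :
  s * negbin_scaled (s + 1) n = (s + n%:R) / n.+1%:R * negbin_scaled s n.
Proof.
have n0 : n.+1%:R != 0 :> R by rewrite pnatr_eq0.
rewrite /negbin_scaled.
have -> : n.+1%:R `^ (1 - (s + 1)) = n.+1%:R `^ (1 - s) / n.+1%:R :> R.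
  by rewrite -[X in _ / X](@powRr1 _ n.+1%:R)// -powRB ?n0 ?implybT//; congr (_ `^ _); ring.
by rewrite mulrCA -negbinD1; ring.
Qed.

Lemma cvg_shift_ratio s : ((s + n%:R) / n.+1%:R : R) @[n --> \oo] --> (1 : R).
Proof.
have -> : (fun n => (s + n%:R) / n.+1%:R : R) = (fun n => 1 + (s - 1) * harmonic n).
  apply/funext => n; rewrite /harmonic/=.
  have n0 : n.+1%:R != 0 :> R by rewrite pnatr_eq0.
  by rewrite -natr1 in n0 *; field.
suff : (1 + (s - 1) * harmonic n : R) @[n --> \oo] --> (1 + (s - 1) * 0 : R).
  by rewrite mulr0 addr0.
by apply: cvgD; [exact: cvg_cst|apply: cvgM; [exact: cvg_cst|exact: cvg_harmonic]].
Qed.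

(** Wendel's inequality, used from n + 1 to n + 1 + th and from n + 1 + th to
   n + 2, squeezes the quotient of Gamma functions. *)
Lemma negbin_scaled_cvg_base th : 0 <= th <= 1 ->
  negbin_scaled (1 + th) @ \oo --> rgamma (1 + th).
Proof.
move=> th01; have /andP[th0 th1] := th01.
pose q (n : nat) : R := n.+1%:R `^ (- th) * (Gamma (n.+1%:R + th) / Gamma n.+1%:R).
have -> : negbin_scaled (1 + th) = fun n => rgamma (1 + th) * q n.
  apply/funext => n; rewrite /negbin_scaled /q.
  have G0 : Gamma n.+1%:R != 0 :> R by rewrite gt_eqF// Gamma_gt0.
  have s0 : 0 < 1 + th + n%:R by rewrite ltr_pwDl// ltr_pwDl.
  have -> : n.+1%:R + th = 1 + th + n%:R by rewrite -nat1r; ring.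
  have -> : negbin (1 + th) n = rgamma (1 + th) * (Gamma (1 + th + n%:R) / Gamma n.+1%:R).
    by apply: (mulIf G0); rewrite rgamma_negbin// -mulrA divfK.
  by rewrite mulrCA; congr (_ * (_ `^ _ * _)); ring.
rewrite -[X in _ --> X]mulr1; apply: cvgM; first exact: cvg_cst.
apply: (@squeeze_cvgr _ _ _ _ (fun n => (((th + 1) + n%:R) / n.+1%:R)^-1) (fun=> 1)); last 2 first.
- by rewrite -[X in _ --> X]invr1; apply: cvgV; [exact: oner_neq0|exact: cvg_shift_ratio].
- exact: cvg_cst.
apply: nearW => n; set x : R := n.+1%:R.
have x0 : 0 < x by rewrite ltr0n.
have G0 := Gamma_gt0 x0.
have xt0 : 0 < x + th by rewrite ltr_pwDl.
have p0 : 0 < x `^ th by rewrite powR_gt0.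
rewrite /q -/x powRN; apply/andP; split; last first.
  by rewrite mulrA ler_pdivrMr// mul1r ler_pdivrMl// Gamma_le_powR.
have th01' : 0 <= 1 - th <= 1 by lra.
have := Gamma_le_powR xt0 th01'.
have -> : x + th + (1 - th) = x + 1 by ring.
rewrite Gamma_rec_pos// => h.
have -> : th + 1 + n%:R = x + th by rewrite /x -nat1r; ring.
rewrite invf_div.
have h2 : (x + th) `^ (1 - th) <= (x + th) / x * (x / x `^ th).
  have -> : x / x `^ th = x `^ (1 - th).
    by rewrite powRB ?(gt_eqF x0) ?implybT// powRr1// ltW.
  have xn0 : x != 0 by rewrite gt_eqF.
  rewrite -[in leLHS](divfK xn0 (x + th)) powRM; last 2 first.
  - by rewrite divr_ge0 ?ltW.
  - exact: ltW.
  rewrite ler_wpM2r ?powR_ge0// ler1_powR//; last by lra.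
  by rewrite ler_pdivlMr// mul1r lerDl.
have h3 := le_trans h (ler_wpM2r (ltW (Gamma_gt0 xt0)) h2).
rewrite ler_pdivrMr//.
have -> : (x `^ th)^-1 * (Gamma (x + th) / Gamma x) * (x + th) =
   ((x + th) / x * (x / x `^ th) * Gamma (x + th)) / Gamma x.
  by field; rewrite !gt_eqF.
by rewrite ler_pdivlMr.
Qed.

(** Euler's limit formula. The step s -> s + 1 is invertible for large n, which
   extends the interval [1, 2] to the whole line. *)
Lemma negbin_scaled_cvg s : negbin_scaled s @ \oo --> rgamma s.
Proof.
have up t : 0 < t -> negbin_scaled t @ \oo --> rgamma t ->
    negbin_scaled (t + 1) @ \oo --> rgamma (t + 1).
  move=> t0 ht; have t0' : t != 0 by rewrite gt_eqF.
  have -> : rgamma (t + 1) = t^-1 * (1 * rgamma t) by rewrite mul1r (rgamma_rec t) mulKf.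
  have -> : negbin_scaled (t + 1) = fun n => t^-1 * ((t + n%:R) / n.+1%:R * negbin_scaled t n).
    by apply/funext => n; rewrite -negbin_scaled_shift mulKf.
  apply: cvgM; first exact: cvg_cst.
  by apply: cvgM ht; exact: cvg_shift_ratio.
have down t : negbin_scaled (t + 1) @ \oo --> rgamma (t + 1) ->
    negbin_scaled t @ \oo --> rgamma t.
  move=> ht.
  have h : ((t + n%:R) / n.+1%:R)^-1 * (t * negbin_scaled (t + 1) n) @[n --> \oo] -->
      1^-1 * (t * rgamma (t + 1)).
    apply: cvgM; first by apply: cvgV; [exact: oner_neq0|exact: cvg_shift_ratio].
    by apply: cvgM; [exact: cvg_cst|].
  rewrite invr1 mul1r -rgamma_rec in h.
  apply: cvg_trans h; apply: near_eq_cvg; near=> n.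
  rewrite negbin_scaled_shift mulKf//.
  rewrite mulf_neq0 ?invr_eq0 ?pnatr_eq0// gt_eqF//.
  near: n; exists (Num.truncn (- t)).+1 => // n/= hn.
  by rewrite (lt_le_trans (truncnNS_gt t))// lerD2l ler_nat.
have big1 t : 1 <= t -> negbin_scaled t @ \oo --> rgamma t.
  move=> t1; pose m := Num.truncn (t - 1).
  have /andP[h1 h2] : m%:R <= t - 1 < m.+1%:R by apply: truncn_itv; rewrite subr_ge0.
  have -> : t = 1 + (t - 1 - m%:R) + m%:R by ring.
  have : 0 <= t - 1 - m%:R <= 1 by rewrite -natr1 in h2; lra.
  move: (t - 1 - m%:R) => th th01; elim: {h1 h2}m => [|m ih].
    by rewrite addr0; exact: negbin_scaled_cvg_base.
  rewrite -natr1 addrA; apply: up ih.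
  by case/andP: th01 => ? ?; rewrite ltr_pwDl// ltr_pwDl.
have := @big1 (s + (Num.truncn (1 - s)).+1%:R).
have h : 1 <= s + (Num.truncn (1 - s)).+1%:R.
  by rewrite -lerBlDl; exact/ltW/truncnS_gt.
move=> /(_ h); move: (_.+1) => m; elim: m {h} => [|m ih]; first by rewrite addr0.
by rewrite -natr1 addrA => /down.
Unshelve. all: by end_near. Qed.

End negbin.

(** * A majorant for the scaled coefficients *)

Section negbin_bound.
Context {R : realType}.
Implicit Types (s p q a beta : R) (n k : nat).

Lemma negbin_scaledS s n : negbin_scaled s n.+1 =
  negbin_scaled s n * ((s + n%:R) / n.+1%:R * (n.+2%:R / n.+1%:R) `^ (1 - s)).
Proof.
rewrite /negbin_scaled negbinSr.
have -> : n.+2%:R `^ (1 - s) = n.+1%:R `^ (1 - s) * (n.+2%:R / n.+1%:R) `^ (1 - s) :> R.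
  by rewrite -powRM ?divr_ge0// mulrC divfK ?pnatr_eq0.
by ring.
Qed.

(** The step from n to n + 1 costs at most exp (q / (n + 1) - q / (n + 2)), a
   telescoping product. *)
Lemma negbin_scaled_le_expR q n : 0 <= q -> `|negbin_scaled (1 + q) n| <= expR q.
Proof.
move=> q0.
suff : `|negbin_scaled (1 + q) n| <= expR (q * (1 - n.+1%:R^-1)).
  by move/le_trans; apply; rewrite ler_expR ler_piMr// gerBl invr_ge0.
elim: n => [|n ih].
  by rewrite /negbin_scaled negbin0 powR1 mulr1 invr1 subrr mulr0 expR0 normr1.
rewrite negbin_scaledS normrM.
have -> : q * (1 - n.+2%:R^-1) =
  q * (1 - n.+1%:R^-1) + (q / n.+1%:R + - n.+2%:R^-1 * q) by ring.
rewrite expRD ler_pM// expRD ger0_norm; last first.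
  by rewrite mulr_ge0 ?powR_ge0// divr_ge0// !addr_ge0.
have n0 : n.+1%:R != 0 :> R by rewrite pnatr_eq0.
rewrite ler_pM ?powR_ge0//.
- by rewrite divr_ge0// !addr_ge0.
- rewrite (le_trans _ (expR_ge1Dx _))//.
  have -> : 1 + q + n%:R = n.+1%:R + q by rewrite -natr1; ring.
  by rewrite mulrDl divff.
- have -> : 1 - (1 + q) = - q by ring.
  rewrite powRN -invf_div.
  have -> : (n.+1%:R / n.+2%:R)^-1 `^ q = ((n.+1%:R / n.+2%:R) `^ q)^-1 :> R.
    rewrite -powRN -powR_inv1 ?divr_ge0// -powRrM; congr (_ `^ _); ring.
  rewrite invrK expRM ge0_ler_powR ?nnegrE ?expR_ge0 ?divr_ge0//.
  rewrite (le_trans _ (expR_ge1Dx _))// ler_pdivrMr//.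
  rewrite mulrBl mul1r mulVf ?pnatr_eq0//.
  by rewrite lerBrDr natr1.
Qed.

Lemma negbin_norm_le p n : 0 <= p -> `|negbin (1 - p) n| <= (1 + p) ^+ n.
Proof.
move=> p0; rewrite /negbin normr_prod -[X in _ <= _ ^+ X]card_ord -prodr_const.
apply: ler_prod => j _; rewrite normr_ge0/= normrM normfV (ger0_norm (ler0n _ _)).
rewrite ler_pdivrMr//.
have -> : 1 - p + j%:R = j.+1%:R - p by rewrite -natr1; ring.
rewrite (le_trans (ler_normB _ _))// ger0_norm// ger0_norm// mulrDl mul1r lerD2l.
by rewrite ler_peMr// ler1n.
Qed.

(** The absolute values do not increase once n + 1 > p, since (1 - h p) (1 + h) ^ p
   is at most 1 for h = 1 / (n + 1); before that each factor is at most 1 + p. *)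
Lemma negbin_scaled_le_powR p n : 0 <= p ->
  `|negbin_scaled (1 - p) n| <= (1 + p) `^ (2 * p).
Proof.
move=> p0.
have small m : m%:R <= p -> `|negbin_scaled (1 - p) m| <= (1 + p) `^ (2 * p).
  move=> mp; rewrite /negbin_scaled normrM (ger0_norm (powR_ge0 _ _)).
  have -> : 1 - (1 - p) = p by ring.
  have -> : 2 * p = p + p by ring.
  rewrite powRD; last by apply/implyP => _; rewrite gt_eqF// ltr_pwDl.
  rewrite ler_pM ?powR_ge0//.
    by rewrite ge0_ler_powR ?nnegrE ?addr_ge0// -nat1r lerD2l.
  rewrite (le_trans (negbin_norm_le _ p0))// -powR_mulrn ?addr_ge0//.
  by rewrite ler_powR// lerDl.
elim: n => [|n ih]; first by apply: small.
have [np|pn] := leP n.+1%:R p; first exact: small.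
apply: le_trans ih; rewrite negbin_scaledS normrM ler_piMr//.
have -> : 1 - (1 - p) = p by ring.
have -> : 1 - p + n%:R = n.+1%:R - p by rewrite -natr1; ring.
have n0 : n.+1%:R != 0 :> R by rewrite pnatr_eq0.
rewrite ger0_norm; last by rewrite mulr_ge0 ?powR_ge0// divr_ge0// subr_ge0 ltW.
apply: (@le_trans _ _ (expR (- (p / n.+1%:R)) * expR (n.+1%:R^-1 * p))); last first.
  by rewrite -expRD [_^-1 * p]mulrC addNr expR0.
rewrite ler_pM ?powR_ge0//.
- by rewrite divr_ge0// subr_ge0 ltW.
- by rewrite (le_trans _ (expR_ge1Dx _))// mulrBl divff.
- rewrite expRM ge0_ler_powR ?nnegrE ?expR_ge0 ?divr_ge0//.
  by rewrite (le_trans _ (expR_ge1Dx _))// -natr1 mulrDl divff// mul1r.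
Qed.

Lemma negbin_scaled_norm_le s n :
  `|negbin_scaled s n| <= expR `|1 - s| * (1 + `|1 - s|) `^ (2 * `|1 - s|).
Proof.
have [p0|/ltW p0] := leP 0 (1 - s).
  rewrite (ger0_norm p0); have := negbin_scaled_le_powR n p0.
  have -> : 1 - (1 - s) = s by ring.
  by move/le_trans; apply; rewrite ler_peMl ?powR_ge0// -[leLHS]expR0 ler_expR.
rewrite (ler0_norm p0) opprB.
have q0 : 0 <= s - 1 by rewrite -opprB oppr_ge0.
have := negbin_scaled_le_expR n q0; have -> : 1 + (s - 1) = s by ring.
move/le_trans; apply; rewrite ler_peMr ?expR_ge0//.
rewrite -[leLHS](powRr0 s).
by rewrite ler_powR ?mulr_ge0// -subr_ge0.
Qed.

(** The majorant behind every exchange of limit and sum. For s = beta - a k the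
   bound of [negbin_scaled_norm_le] grows like k ^ (2 a k), that is like
   (k!) ^ (2 a) up to a geometric factor; 2 a < 1 is what the Wright series
   needs. *)
Lemma negbin_scaled_subfactorial a beta : 0 <= a <= 1 ->
  exists AC : R * R, [/\ 0 <= AC.1, 0 <= AC.2 &
  forall n, subfactorial AC.1 AC.2 (2 * a) (fun k => negbin_scaled (beta - a * k%:R) n)].
Proof.
move=> /andP[a0 a1]; pose D := 1 + `|beta|.
have D0 : 0 <= D by rewrite addr_ge0.
pose L := ln (1 + D).
have LE y : (1 + D) `^ y = expR (y * L) by rewrite /powR gt_eqF// ltr_pwDl.
exists (expR (D + 2 * a + 2 * D * L), expR (3 * a + 2 * a * L + 2 * D)).
split; rewrite ?expR_ge0// => n k /=.
set s := beta - a * k%:R.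
have pD : `|1 - s| <= D + a * k%:R.
  rewrite /s opprB addrCA addrC (le_trans (ler_normD _ _))// lerD//.
    by rewrite (le_trans (ler_normB _ _))// normr1.
  by rewrite ger0_norm// mulr_ge0.
set p := `|1 - s| in pD.
have p0 : 0 <= p by exact: normr_ge0.
rewrite (le_trans (negbin_scaled_norm_le _ _))// -/p.
set y := D + a * k%:R in pD.
have y0 : 0 <= y by rewrite addr_ge0// mulr_ge0.
have b1 : 1 + p <= (1 + D) * k.+1%:R.
  have ak : a * k%:R <= k%:R by rewrite ler_piMl.
  have Dk : 0 <= D * k%:R by rewrite mulr_ge0.
  by rewrite -natr1; rewrite /y in pD; lra.
have k1 : k.+1%:R != 0 :> R by rewrite pnatr_eq0.
have b2 : (1 + p) `^ (2 * p) <= ((1 + D) * k.+1%:R) `^ (2 * y).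
  apply: (@le_trans _ _ ((1 + p) `^ (2 * y))).
    by rewrite ler_powR ?lerDl// ler_wpM2l.
  apply: ge0_ler_powR b1; rewrite ?nnegrE; [exact: mulr_ge0|exact: addr_ge0|].
  by apply: mulr_ge0 => //; exact: addr_ge0.
have b3 : k.+1%:R `^ (2 * y) <= expR (k%:R * (2 * D)) * (expR (k.+1%:R * (2 * a)) * k`!%:R `^ (2 * a)).
  have -> : 2 * y = 2 * D + k%:R * (2 * a) by rewrite /y; ring.
  rewrite powRD ?k1 ?implybT//.
  rewrite ler_pM ?powR_ge0//.
    rewrite expRM ge0_ler_powR ?nnegrE ?expR_ge0 ?mulr_ge0//.
    by rewrite -nat1r expR_ge1Dx.
  rewrite powRrM powR_mulrn// expRM -powRM ?expR_ge0//.
  rewrite ge0_ler_powR ?nnegrE ?exprn_ge0 ?mulr_ge0 ?expR_ge0//.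
  by rewrite -ler_pdivrMr ?ltr0n ?fact_gt0// expr_fact_le.
apply: (@le_trans _ _ (expR y * (expR (2 * y * L) *
    (expR (k%:R * (2 * D)) * (expR (k.+1%:R * (2 * a)) * k`!%:R `^ (2 * a)))))).
  rewrite ler_pM ?expR_ge0 ?powR_ge0 ?ler_expR// (le_trans b2)//.
  by rewrite powRM ?addr_ge0// LE ler_wpM2l ?expR_ge0.
rewrite !mulrA -!expRD -expRM_natl -expRD ler_wpM2r ?powR_ge0// ler_expR.
by rewrite /y -natr1; lra.
Qed.

Lemma rgamma_subfactorial a beta : 0 <= a <= 1 ->
  exists AC : R * R, [/\ 0 <= AC.1, 0 <= AC.2 &
    subfactorial AC.1 AC.2 (2 * a) (fun k => rgamma (beta - a * k%:R))].
Proof.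
move=> a01; have [[A C] [A0 C0 AC]] := negbin_scaled_subfactorial beta a01.
exists (A, C); split => //.
by apply: (subfactorial_lim AC) => k; exact: negbin_scaled_cvg.
Qed.

End negbin_bound.

(** * The Wright function as a limit of discrete convolutions *)

Section egf_algebra.
Context {R : realType}.
Implicit Types (g h : nat -> R) (c z : R).

Definition egf_summable g z := cvgn (series (fun k => z ^+ k / k`!%:R * g k)).

Lemma egf_cvgn g z : egf_summable g z ->
  series (fun k => z ^+ k / k`!%:R * g k) @ \oo --> egf g z.
Proof. by []. Qed.

Lemma eq_egf g h z : g =1 h -> egf g z = egf h z.
Proof. by move=> /funext ->. Qed.

Lemma egf_scale c g h z z' : (forall k, c * (z ^+ k * g k) = z' ^+ k * h k) ->
  egf_summable g z -> c * egf g z = egf h z'.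
Proof.
move=> E cg; apply/esym/cvg_lim => //.
have -> : series (fun k => z' ^+ k / k`!%:R * h k) =
    fun n => c * series (fun k => z ^+ k / k`!%:R * g k) n.
  apply/funext => n; rewrite /series/= big_distrr/=; apply: eq_bigr => k _.
  by rewrite mulrAC -E; ring.
by apply: cvgM; [exact: cvg_cst|exact: egf_cvgn].
Qed.

Lemma egf_sum n (c : 'I_n -> R) (g : 'I_n -> nat -> R) z :
  (forall j, egf_summable (g j) z) ->
  egf (fun k => \sum_(j < n) c j * g j k) z = \sum_(j < n) c j * egf (g j) z.
Proof.
move=> cg; apply: cvg_lim => //.
have -> : series (fun k => z ^+ k / k`!%:R * \sum_(j < n) c j * g j k) =
    fun m => \sum_(j < n) c j * series (fun k => z ^+ k / k`!%:R * g j k) m.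
  apply/funext => m; rewrite /series/=.
  under [RHS]eq_bigr do rewrite big_distrr/=.
  rewrite exchange_big/=; apply: eq_bigr => k _; rewrite big_distrr/=.
  by apply: eq_bigr => j _; ring.
apply: cvg_big => //; first exact: add_continuous.
by move=> j _; apply: cvgM; [exact: cvg_cst|exact: egf_cvgn].
Qed.

Lemma egf_linear c d g h z : egf_summable g z -> egf_summable h z ->
  egf (fun k => c * g k + d * h k) z = c * egf g z + d * egf h z.
Proof.
move=> cg ch; apply: cvg_lim => //.
have -> : series (fun k => z ^+ k / k`!%:R * (c * g k + d * h k)) =
    fun m => c * series (fun k => z ^+ k / k`!%:R * g k) m +
             d * series (fun k => z ^+ k / k`!%:R * h k) m.
  apply/funext => m; rewrite /series/= 2!big_distrr/= -big_split/=.
  by apply: eq_bigr => k _; ring.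
by apply: cvgD; apply: cvgM; [exact: cvg_cst|exact: egf_cvgn|exact: cvg_cst|exact: egf_cvgn].
Qed.

Lemma egf_mulk_cvg g z : egf_summable (fun k => g k.+1) z ->
  series (fun k => z ^+ k / k`!%:R * (k%:R * g k)) @ \oo --> z * egf (fun k => g k.+1) z.
Proof.
move=> cg; rewrite -cvg_shiftS.
have -> : (fun n => series (fun k => z ^+ k / k`!%:R * (k%:R * g k)) n.+1) =
   (fun n => z * series (fun k => z ^+ k / k`!%:R * g k.+1) n).
  apply/funext => n; rewrite /series/= big_nat_recl//= mul0r mulr0 add0r big_distrr/=.
  apply: eq_bigr => k _; rewrite factS natrM exprS invfM.
  have k0 : k.+1%:R != 0 :> R by rewrite pnatr_eq0.
  by rewrite -!mulrA; congr (_ * (_ * _)); rewrite mulrCA mulKf.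
by apply: cvgM; [exact: cvg_cst|exact: egf_cvgn].
Qed.

Lemma egf_mulk g z : egf_summable (fun k => g k.+1) z ->
  egf (fun k => k%:R * g k) z = z * egf (fun k => g k.+1) z.
Proof. by move=> /egf_mulk_cvg/cvg_lim; apply. Qed.

Lemma egf_mulk_summable g z : egf_summable (fun k => g k.+1) z ->
  egf_summable (fun k => k%:R * g k) z.
Proof. by move=> /egf_mulk_cvg h; apply/cvg_ex; eexists; exact: h. Qed.

End egf_algebra.

Section wright_discrete.
Context {R : realType}.
Variable a : R.
Hypotheses (a_gt0 : 0 < a) (a_lt : a < 1 / 2).
Implicit Types (b x y z s u : R) (n k : nat).

Let a01 : 0 <= a <= 1. Proof. by move: a_gt0 a_lt => ? ?; lra. Qed.
Let th1 : 2 * a < 1. Proof. by move: a_lt => ?; lra. Qed.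

(** W(- x, - a, b) *)
Definition wrightN b x : R := egf (fun k => rgamma (b - a * k%:R)) (- x).

Lemma wrightE z b : wright z (- a) b = wrightN b (- z).
Proof.
rewrite /wright /wrightN /egf opprK; congr (limn (series _)).
by apply/funext => k; rewrite invfM mulrA mulNr addrC.
Qed.

Lemma rgamma_summable b z : egf_summable (fun k => rgamma (b - a * k%:R)) z.
Proof.
have [[A C] /= [A0 C0 AC]] := rgamma_subfactorial b a01.
exact: (egf_cvg A0 C0 th1 AC).
Qed.

Lemma shiftE b k : b - a * k.+1%:R = b - a - a * k%:R.
Proof. by rewrite -natr1; ring. Qed.

Lemma wrightN0 b : wrightN b 0 = rgamma b.
Proof. by rewrite /wrightN oppr0 egf0 mulr0 subr0. Qed.

Lemma is_derive_wrightN b x : is_derive x 1 (wrightN b) (- wrightN (b - a) x).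
Proof.
have [[A C] /= [A0 C0 AC]] := rgamma_subfactorial b a01.
have h := is_derive_egf (- x) A0 C0 th1 AC.
have hN : is_derive x 1 (fun x : R => - x) (- 1) by exact: is_deriveN.
apply: is_derive_eq (is_derive1_comp h hN) _.
by rewrite mulrN1; congr (- _); apply: eq_egf => k; rewrite shiftE.
Qed.

(** The recurrence 1 / Gamma (s - 1) = (s - 1) / Gamma s at s = b - a k; the
   factor k shifts the generating function. *)
Lemma wrightN_rec b x :
  wrightN (b - 1) x = (b - 1) * wrightN b x + a * x * wrightN (b - a) x.
Proof.
have E : (fun k : nat => rgamma (b - 1 - a * k%:R)) =
    (fun k => (b - 1) * rgamma (b - a * k%:R) + (- a) * (k%:R * rgamma (b - a * k%:R))).
  apply/funext => k; rewrite rgamma_rec.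
  have -> : b - 1 - a * k%:R + 1 = b - a * k%:R by ring.
  by ring.
have S : egf_summable (fun k => rgamma (b - a * k.+1%:R)) (- x).
  have := @rgamma_summable (b - a) (- x); rewrite /egf_summable.
  by under eq_fun do rewrite -shiftE.
rewrite /wrightN E egf_linear; [|exact: rgamma_summable|].
  rewrite (egf_mulk S) mulrA mulrNN; congr (_ + _ * _).
  by apply: eq_egf => k; rewrite shiftE.
exact: (egf_mulk_summable S).
Qed.

(** The coefficient of w ^ n in (1 - w) ^ (- b) exp (- x (1 - w) ^ a). *)
Definition dwright b n x : R := egf (fun k => negbin (b - a * k%:R) n) (- x).

Lemma negbin_subfactorial b n : exists AC : R * R, [/\ 0 <= AC.1, 0 <= AC.2 &
    subfactorial AC.1 AC.2 (2 * a) (fun k => negbin (b - a * k%:R) n)].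
Proof.
have [[A C] /= [A0 C0 AC]] := negbin_scaled_subfactorial b a01.
exists (n.+1%:R `^ (b - 1) * A, C); split => //=; first by rewrite mulr_ge0 ?powR_ge0.
move=> k /=; have := AC n k => /= h.
rewrite negbin_unscale.
have -> : b - a * k%:R - 1 = b - 1 - a * k%:R by ring.
rewrite normrM ger0_norm ?powR_ge0// -!mulrA ler_pM ?powR_ge0//; last by rewrite mulrA.
by rewrite ler_powR ?ler1n// gerBl mulr_ge0// ltW.
Qed.

Lemma negbin_summable b n z : egf_summable (fun k => negbin (b - a * k%:R) n) z.
Proof.
have [[A C] /= [A0 C0 AC]] := negbin_subfactorial b n.
exact: (egf_cvg A0 C0 th1 AC).
Qed.

Lemma dwright0 b n : dwright b n 0 = negbin b n.
Proof. by rewrite /dwright oppr0 egf0 mulr0 subr0. Qed.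

Lemma is_derive_dwright b n x :
  is_derive x 1 (dwright b n) (- dwright (b - a) n x).
Proof.
have [[A C] /= [A0 C0 AC]] := negbin_subfactorial b n.
have h := is_derive_egf (- x) A0 C0 th1 AC.
have hN : is_derive x 1 (fun x : R => - x) (- 1) by exact: is_deriveN.
apply: is_derive_eq (is_derive1_comp h hN) _.
by rewrite mulrN1; congr (- _); apply: eq_egf => k; rewrite shiftE.
Qed.

Lemma dwrightD b u n x :
  dwright (b + u) n x = \sum_(j < n.+1) negbin u (n - j)%N * dwright b j x.
Proof.
rewrite /dwright -egf_sum; last by move=> j; exact: negbin_summable.
apply: eq_egf => k; rewrite negbinD; congr (negbin _ _); ring.
Qed.

(** The w-derivative of exp (- x (1 - w) ^ a) is
   a x (1 - w) ^ (a - 1) exp (- x (1 - w) ^ a). *)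
Lemma dwright_rec n x : n.+1%:R * dwright 0 n.+1 x = a * x * dwright (1 - a) n x.
Proof.
have S : egf_summable (fun k => negbin (1 - a * k.+1%:R) n) (- x).
  have := @negbin_summable (1 - a) n (- x); rewrite /egf_summable.
  by under eq_fun do rewrite -shiftE.
have H : n.+1%:R * dwright 0 n.+1 x =
    - a * egf (fun k => k%:R * negbin (1 - a * k%:R) n) (- x).
  have a0 : - a != 0 by rewrite oppr_eq0 lt0r_neq0.
  rewrite -[LHS](mulVKf a0); congr (_ * _); rewrite mulrA /dwright.
  apply: egf_scale => [k|]; last exact: negbin_summable.
  rewrite -mulrA [_ * (_ * negbin _ _)]mulrCA negbinS_shift.
  have -> : 0 - a * k%:R + 1 = 1 - a * k%:R by ring.
  by field; rewrite gt_eqF.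
rewrite H (@egf_mulk _ (fun k => negbin (1 - a * k%:R) n) _ S) mulrA mulrNN.
by congr (_ * _); apply: eq_egf => k; rewrite shiftE.
Qed.

(** By [dwright_rec] each coefficient of exp (- x (1 - w) ^ a) is a combination of
   the previous ones with nonnegative weights, those of (1 - w) ^ (a - 1); the
   factor (1 - w) ^ (- b) has nonnegative coefficients too. *)
Lemma dwright_ge0 b n x : 0 <= b -> 0 <= x -> 0 <= dwright b n x.
Proof.
move=> b0 x0.
suff h0 : forall m, 0 <= dwright 0 m x.
  by rewrite -[b]add0r dwrightD; apply: sumr_ge0 => j _; rewrite mulr_ge0 ?negbin_ge0.
elim/ltn_ind => -[_|m ih].
  have -> : dwright 0 0 x = expR (- x); last exact: expR_ge0.
  rewrite /dwright /egf /expR; congr (limn (series _)); apply/funext => k.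
  by rewrite negbin0 mulr1.
rewrite -(pmulr_rge0 _ (ltr0Sn R m)) dwright_rec mulr_ge0 ?mulr_ge0 ?(ltW a_gt0)//.
rewrite -[1 - a]add0r dwrightD; apply: sumr_ge0 => j _.
have h1a : 0 <= 1 - a by move: a01 => /andP[_]; rewrite subr_ge0.
by rewrite mulr_ge0 ?ih ?ltn_ord// negbin_ge0.
Qed.

Lemma dwright_scaledE b n x : n.+1%:R `^ (1 - b) * dwright b n x =
  egf (fun k => negbin_scaled (b - a * k%:R) n) (- (x * n.+1%:R `^ (- a))).
Proof.
apply: egf_scale; last exact: negbin_summable.
move=> k; rewrite -(mulNr x) exprMn -(powR_mulrn k (powR_ge0 n.+1%:R (- a))) -powRrM /negbin_scaled.
have n0 : n.+1%:R != 0 :> R by rewrite pnatr_eq0.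
have -> : n.+1%:R `^ (1 - b) = n.+1%:R `^ (- a * k%:R) * n.+1%:R `^ (1 - (b - a * k%:R)) :> R.
  by rewrite -powRD ?n0 ?implybT//; congr (_ `^ _); ring.
by ring.
Qed.

(** The scaling limit. With x of order n ^ a, the k-th term of the discrete series
   carries exactly the power of n which Euler's limit formula requires at
   s = b - a k. *)
Lemma dwright_cvg b (N : nat -> nat) (X : nat -> R) y : N @ \oo --> \oo ->
  X i * (N i).+1%:R `^ (- a) @[i --> \oo] --> y ->
  (N i).+1%:R `^ (1 - b) * dwright b (N i) (X i) @[i --> \oo] --> wrightN b y.
Proof.
move=> Noo Xy; under eq_fun do rewrite dwright_scaledE.
have [[A C] /= [A0 C0 AC]] := negbin_scaled_subfactorial b a01.
apply: (@egf_cvg_seq _ A C (2 * a) A0 C0 th1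
  (fun i k => negbin_scaled (b - a * k%:R) (N i)) _
  (fun i => - (X i * (N i).+1%:R `^ (- a)))).
- by move=> i; exact: AC.
- by move=> k; exact: (cvg_comp _ _ Noo (@negbin_scaled_cvg _ _)).
- exact: cvgN.
Qed.

(** Positivity is inherited from the discrete coefficients. *)
Lemma wrightN_ge0 b x : 0 <= b -> 0 <= x -> 0 <= wrightN b x.
Proof.
move=> b0 x0.
have h : (fun i : nat => i.+1%:R `^ (1 - b) * dwright b i (x * i.+1%:R `^ a)) @ \oo -->
    wrightN b x.
  apply: (@dwright_cvg b id) => //.
  rewrite (_ : (fun i => _) = fun=> x); first exact: cvg_cst.
  apply/funext => i; rewrite powRN mulfK// gt_eqF// powR_gt0//.
rewrite -(cvg_lim _ h)//; apply: limr_ge; first by apply/cvg_ex; eexists; exact: h.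
apply: nearW => i; rewrite mulr_ge0 ?powR_ge0// dwright_ge0//.
by rewrite mulr_ge0 ?powR_ge0.
Qed.

End wright_discrete.

(** * Monotonicity, decay and strict positivity *)

Section wright_analysis.
Context {R : realType}.
Variable a : R.
Hypotheses (a_gt0 : 0 < a) (a_lt : a < 1 / 2).
Implicit Types (b x y z : R) (n k : nat).
Local Notation W := (wrightN a).

Let dW b x := is_derive_wrightN a_gt0 a_lt b x.
Let W_ge0 b x : 0 <= b -> 0 <= x -> 0 <= W b x := @wrightN_ge0 _ _ a_gt0 a_lt b x.

Lemma wrightN_continuous b : continuous (W b).
Proof. by move=> x; exact: is_derive_continuous (dW b x). Qed.

Lemma wrightN_nonincreasing b x y : a <= b -> 0 <= x <= y -> W b y <= W b x.
Proof.
move=> ab /andP[x0 xy].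
apply: (nonincreasing_of_derive xy (fun z _ => dW b z)) => z /andP[xz _].
by rewrite oppr_le0 W_ge0 ?subr_ge0// (le_trans x0).
Qed.

(** - W b is the derivative of W (b + a), which is nonnegative, and W b is
   nonincreasing: x / 2 times W b x is at most the decrease of W (b + a) over
   the interval from x / 2 to x. *)
Lemma wrightN_halve b x : a <= b -> 0 <= x -> x * W b x <= 2 * W (b + a) (x / 2).
Proof.
move=> ab x0; have x2 : x / 2 <= x by lra.
have b0 : 0 <= b by exact: le_trans (ltW a_gt0) ab.
have [z /andP[xz zx]] := mean_value x2 (fun z _ => dW (b + a) z).
rewrite addrK => E.
have z0 : 0 <= z by apply: le_trans xz; rewrite divr_ge0.
have h1 : W b x <= W b z by rewrite wrightN_nonincreasing// z0.
have h2 : 0 <= W (b + a) x by rewrite W_ge0// addr_ge0// ltW.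
have h3 : x * W b x <= x * W b z by rewrite ler_wpM2l.
lra.
Qed.

Lemma wrightN_decay_pos n b : a <= b ->
  exists C, forall x, 0 < x -> x ^+ n * W b x <= C.
Proof.
elim: n b => [|n ih] b ab.
  exists (W b 0) => x x0; rewrite expr0 mul1r wrightN_nonincreasing//.
  by rewrite lexx ltW.
have aba : a <= b + a by rewrite lerDr (le_trans (ltW a_gt0)).
have [C hC] := ih _ aba.
exists (2 ^+ n.+1 * C) => x x0.
have x20 : 0 < x / 2 by rewrite divr_gt0.
rewrite exprSr -mulrA (@le_trans _ _ (x ^+ n * (2 * W (b + a) (x / 2))))//.
  by rewrite ler_wpM2l ?exprn_ge0 ?(ltW x0)// wrightN_halve// ltW.
have -> : x ^+ n * (2 * W (b + a) (x / 2)) =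
    2 ^+ n.+1 * ((x / 2) ^+ n * W (b + a) (x / 2)).
  have -> : x ^+ n = 2 ^+ n * (x / 2) ^+ n.
    by rewrite -exprMn; congr (_ ^+ n); field.
  by rewrite exprS; ring.
by rewrite ler_wpM2l ?exprn_ge0// hC.
Qed.

Definition rapidly_decreasing (f : R -> R) :=
  forall n, exists C, forall x, 0 < x -> x ^+ n * `|f x| <= C.

Lemma rapidly_decreasing_rec b : rapidly_decreasing (W (b + 1)) ->
  rapidly_decreasing (W (b + 1 - a)) -> rapidly_decreasing (W b).
Proof.
move=> h1 h2 n; have [C1 hC1] := h1 n; have [C2 hC2] := h2 n.+1.
exists (`|b| * C1 + a * C2) => x x0.
have -> : W b x = b * W (b + 1) x + a * x * W (b + 1 - a) x.
  by have := wrightN_rec a_gt0 a_lt (b + 1) x; rewrite addrK.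
apply: (@le_trans _ _ (`|b| * (x ^+ n * `|W (b + 1) x|) + a * (x ^+ n.+1 * `|W (b + 1 - a) x|))).
  have -> : `|b| * (x ^+ n * `|W (b + 1) x|) + a * (x ^+ n.+1 * `|W (b + 1 - a) x|) =
     x ^+ n * (`|b * W (b + 1) x| + `|a * x * W (b + 1 - a) x|).
    by rewrite !normrM (gtr0_norm a_gt0) (gtr0_norm x0) exprSr; ring.
  by rewrite ler_wpM2l ?exprn_ge0 ?(ltW x0)// ler_normD.
by apply: lerD; rewrite ler_wpM2l ?hC1 ?hC2// ltW.
Qed.

(** Positivity gives decay for b >= a; the recurrence carries it to every b. *)
Lemma wrightN_decay b : rapidly_decreasing (W b).
Proof.
have pos c : a <= c -> rapidly_decreasing (W c).
  move=> ac n; have [C hC] := wrightN_decay_pos n ac; exists C => x x0.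
  by rewrite ger0_norm ?hC// W_ge0 ?(ltW x0)// (le_trans _ ac)// ltW.
have steps j c : a - j%:R / 2 <= c -> rapidly_decreasing (W c).
  elim: j c => [|j ih] c; first by rewrite mul0r subr0; exact: pos.
  rewrite -natr1 => hc; apply: rapidly_decreasing_rec; apply: ih; move: a_lt a_gt0 => ? ?; lra.
apply: (steps (Num.truncn (2 * (a - b))).+1).
have := truncnS_gt (2 * (a - b)); lra.
Qed.

Lemma wrightN_cvg0 b : W b x @[x --> +oo] --> 0.
Proof.
have [C hC] := wrightN_decay b 1.
apply/cvgrPdist_le => e e0; near=> x.
have x0 : 0 < x by near: x; exact: nbhs_pinfty_gt.
rewrite sub0r normrN -(ler_pM2l x0) -[X in X * `|_|]expr1 (le_trans (hC x x0))//.
rewrite -ler_pdivrMr//; near: x; apply: nbhs_pinfty_ge; exact: num_real.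
Unshelve. all: by end_near. Qed.

Lemma wrightN1_0 : W 1 0 = 1.
Proof. by rewrite wrightN0 rgamma1. Qed.

Lemma wrightN1_le1 x : 0 <= x -> W 1 x <= 1.
Proof.
move=> x0; rewrite -[leRHS]wrightN1_0 wrightN_nonincreasing ?lexx//.
by move: a_lt => ?; lra.
Qed.

(** The slope of W 1 at 0 is - 1 / Gamma (1 - a) < 0. *)
Lemma wrightN1_lt1 x : 0 < x -> W 1 x < 1.
Proof.
move=> x0.
have a1 : a <= 1 by move: a_lt => ?; lra.
have p0 : 0 < W (1 - a) 0 by rewrite wrightN0 rgamma_gt0//; move: a_lt => ?; lra.
have [d /= d0 hd] := cvgr_gt _ (@wrightN_continuous (1 - a) 0) _ p0.
pose y := Num.min x (d / 2).
have y0 : 0 < y by rewrite lt_min x0 divr_gt0.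
have yx : y <= x by rewrite ge_min lexx.
apply: le_lt_trans (_ : W 1 y < 1).
  by rewrite wrightN_nonincreasing// ltW.
have [z /andP[z0 zy]] := mean_value (ltW y0) (fun z _ => dW 1 z).
rewrite wrightN1_0 subr0 => E.
have Wz : 0 < W (1 - a) z.
  apply: hd; rewrite /= sub0r normrN ger0_norm//; apply: (le_lt_trans zy).
  by rewrite gt_min; apply/orP; right; lra.
by rewrite -subr_lt0 E mulNr oppr_lt0 mulr_gt0.
Qed.

(** If W 1 vanished at x, it would vanish beyond x, hence so would its iterated
   primitives W (1 + n a), which tend to 0 at infinity. Integrating back from x
   gives 1 / Gamma (1 + n a) = W (1 + n a) 0 <= x ^ n / n!, and
   Gamma (1 + n a) <= (n!) ^ a then bounds (n!) ^ (1 - a) by x ^ n for all n. *)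
Lemma wrightN1_gt0 x : 0 <= x -> 0 < W 1 x.
Proof.
move=> x_ge0; rewrite lt0r W_ge0// andbT; apply/eqP => Wx.
have a1 : a <= 1 by move: a_lt => ?; lra.
have na0 n : 0 <= n%:R * a by rewrite mulr_ge0// ltW.
pose V n := W (1 + n%:R * a).
have dV n z : is_derive z 1 (V n.+1) (- V n z).
  apply: is_derive_eq (dW (1 + n.+1%:R * a) z) _; rewrite /V; congr (- W _ z).
  by rewrite -natr1; ring.
have V_ge0 n z : 0 <= z -> 0 <= V n z by apply: W_ge0; rewrite addr_ge0.
have V0 n z : x <= z -> V n z = 0.
  elim: n z => [|n ih] z xz.
    apply/eqP; rewrite eq_le V_ge0 ?(le_trans x_ge0)// andbT /V mul0r addr0 -Wx.
    by rewrite wrightN_nonincreasing// x_ge0.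
  have cst y : z <= y -> V n.+1 y = V n.+1 z.
    move=> zy; have [t /andP[zt _]] := mean_value zy (fun t _ => dV n t).
    by rewrite ih ?(le_trans xz)// oppr0 mul0r => /eqP; rewrite subr_eq0 => /eqP.
  have h0 : V n.+1 y @[y --> +oo] --> 0 by exact: wrightN_cvg0.
  have h1 : V n.+1 y @[y --> +oo] --> V n.+1 z.
    apply: cvg_near_cst; near=> y; apply: cst; near: y; apply: nbhs_pinfty_ge.
    exact: num_real.
  by apply: cvg_unique h1 h0.
have Vle n z : 0 <= z <= x -> V n z <= (x - z) ^+ n / n`!%:R.
  elim: n z => [|n ih] z /andP[z0 zx].
    by rewrite expr0 fact0 divr1 /V mul0r addr0 wrightN1_le1.
  pose h y := (x - y) ^+ n.+1 / n.+1`!%:R - V n.+1 y.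
  suff : h x <= h z by rewrite /h subrr expr0n/= mul0r V0// subrr subr_ge0.
  apply: (nonincreasing_of_derive zx (df := fun y => - ((x - y) ^+ n / n`!%:R) - - V n y)).
    move=> y _; apply: is_deriveB.
    have d1 : is_derive y 1 (fun y : R => x - y) (- 1).
      by apply: is_derive_eq (is_deriveB (is_derive_cst x y 1) (is_derive_id y 1)) _; rewrite sub0r.
    have d2 := is_deriveX n.+1 d1.
    have d3 := is_deriveZ (n.+1`!%:R^-1) d2.
    have -> : (fun y => (x - y) ^+ n.+1 / n.+1`!%:R) =
       n.+1`!%:R^-1 \*: (fun y => x - y) ^+ n.+1.
      by apply/funext => t; rewrite /GRing.scale/= mulrC exprfctE.
    apply: is_derive_eq d3 _; rewrite /GRing.scale/= factS natrM invfM.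
    move: (x - y) => t.
    have n0 : n.+1%:R != 0 :> R by rewrite pnatr_eq0.
    have f0 : n`!%:R != 0 :> R by rewrite pnatr_eq0 -lt0n fact_gt0.
    by move: n.+1%:R n`!%:R n0 f0 => u v u0 v0; field; apply/andP.
  move=> y /andP[zy yx]; rewrite opprK addrC subr_le0 ih//.
  by rewrite (le_trans z0 zy) yx.
have a_lt1 : a < 1 by move: a_lt => ?; lra.
have [K hK] := subfactorial_dominated ler01 ler01 a_lt1 x_ge0.
have [n hn] : exists n, K * 2^-1 ^+ n < 1.
  have h : (fun n => K * 2^-1 ^+ n) @ \oo --> (0 : R).
    by apply: cvg_geometric; rewrite ger0_norm ?invr_ge0// invf_lt1 ?ltr1n.
  have /cvgrPdist_lt/(_ _ ltr01)[n _ hn] := h.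
  exists n; have := hn n (leqnn n); rewrite /= sub0r normrN; exact: le_lt_trans (ler_norm _).
have := Vle n 0; rewrite lexx x_ge0 subr0 => /(_ isT).
rewrite /V wrightN0 /rgamma => h1.
have G0 : 0 < Gamma (1 + n%:R * a) by rewrite Gamma_gt0// ltr_pwDl.
have h2 : Gamma (1 + n%:R * a) <= n`!%:R `^ a.
  by apply: Gamma_natS_le_fact; rewrite (ltW a_gt0).
have f0 : 0 < n`!%:R `^ a :> R by rewrite powR_gt0// ltr0n fact_gt0.
have := hK n; rewrite expr1n !mul1r => /le_lt_trans/(_ hn).
rewrite ltNge => /negP; apply.
rewrite -[leLHS](mulVf (lt0r_neq0 G0)) ler_pM// ?invr_ge0 ltW//.
Unshelve. all: by end_near. Qed.

(** The flux W a decreases while 1 - W 1 increases. *)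
Lemma flux_ratio_nonincreasing x y : 0 < x -> x <= y ->
  W a y / (1 - W 1 y) <= W a x / (1 - W 1 x).
Proof.
move=> x0 xy; have y0 := lt_le_trans x0 xy.
have a1 : a <= 1 by move: a_lt => ?; lra.
have h1 : 0 < 1 - W 1 x by rewrite subr_gt0 wrightN1_lt1.
have h2 : 0 < 1 - W 1 y by rewrite subr_gt0 wrightN1_lt1.
rewrite ler_pM ?W_ge0 ?invr_ge0 ?(ltW a_gt0) ?(ltW y0) ?(ltW h2)//.
  by rewrite wrightN_nonincreasing// (ltW x0).
by rewrite lef_pV2 ?posrE// lerD2l lerN2 wrightN_nonincreasing// (ltW x0).
Qed.

Lemma wrightN_0E x : W 0 x = a * x * W (1 - a) x.
Proof. by rewrite -[0](subrr 1) wrightN_rec// subrr mul0r add0r. Qed.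

Lemma wrightN_aE x : W a x = a * W (1 + a) x + a * x * W 1 x.
Proof.
have := wrightN_rec a_gt0 a_lt (1 + a) x.
by have -> : 1 + a - 1 = a by [ring]; have -> : 1 + a - a = 1 by ring.
Qed.

(** The derivative of W a / W 1 is a W (1 - a) W (1 + a) / (W 1) ^ 2, by the two
   instances of the recurrence above. *)
Lemma flux_ratio_nondecreasing x y : 0 <= x -> x <= y ->
  W a x / W 1 x <= W a y / W 1 y.
Proof.
move=> x0 xy; rewrite -lerN2.
have a1 : a <= 1 by move: a_lt => ?; lra.
apply: (@nonincreasing_of_derive _ (fun z => - (W a z / W 1 z))
  (fun z => - (a * W (1 - a) z * W (1 + a) z / W 1 z ^+ 2))) => // z /andP[xz zy].
  have z0 := le_trans x0 xz; have Wz := wrightN1_gt0 z0.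
  have d1 := dW a z; have d2 := is_deriveV (lt0r_neq0 Wz) (dW 1 z).
  apply: is_derive_eq (is_deriveN (is_deriveM d1 d2)) _.
  rewrite subrr wrightN_0E wrightN_aE /GRing.scale/=.
  by field; exact: lt0r_neq0.
have z0 := le_trans x0 xz; have Wz := wrightN1_gt0 z0.
rewrite oppr_le0 divr_ge0 ?exprn_ge0 ?(ltW Wz)// !mulr_ge0 ?W_ge0 ?subr_ge0 ?(ltW a_gt0)//.
by rewrite addr_ge0// ltW.
Qed.

End wright_analysis.

(** * Step functions and integrable singularities *)

Section step_functions.
Context {R : realType}.
Notation mu := (@lebesgue_measure R).
Implicit Types (h t s : R) (n : nat).

Definition step_fun h n (v : nat -> R) s : R :=
  \sum_(j < n) v j * \1_(`[j%:R * h, j.+1%:R * h[%classic) s.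

Lemma step_funE h n v s : 0 < h -> 0 <= s < n%:R * h ->
  step_fun h n v s = v (Num.truncn (s / h)).
Proof.
move=> h0 /andP[s0 sn].
have sh0 : 0 <= s / h by rewrite divr_ge0// ltW.
have Jn : (Num.truncn (s / h) < n)%N by rewrite truncn_lt_nat// ltr_pdivrMr.
have mem (j : nat) : s \in `[j%:R * h, j.+1%:R * h[%classic = (j == Num.truncn (s / h)).
  rewrite mem_setE in_itv/= -ler_pdivlMr// -ltr_pdivrMr//.
  by rewrite eq_sym truncn_eq.
rewrite /step_fun (bigD1 (Ordinal Jn))//= indicE mem eqxx mulr1 big1 ?addr0// => j jJ.
by rewrite indicE mem -[j == _ :> nat]/(val j == val (Ordinal Jn)) val_eqE (negbTE jJ) mulr0.
Qed.

Lemma measurable_step_fun h n v D : measurable_fun D (step_fun h n v).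
Proof.
by apply: measurable_funTS; apply: measurable_sum => j; apply: measurable_funM.
Qed.

Lemma integral_step_fun h n v : 0 < h -> (forall j, 0 <= v j) ->
  (\int[mu]_(s in `[0%R, (n%:R * h)%R[) (step_fun h n v s)%:E =
   (h * \sum_(j < n) v j)%:E)%E.
Proof.
move=> h0 v0.
under eq_integral do rewrite /step_fun -sumEFin.
rewrite ge0_integral_sum//; last 2 first.
- by move=> j; apply/measurable_EFinP; apply: measurable_funM.
- by move=> j s _; rewrite lee_fin mulr_ge0.
rewrite big_distrr/= -sumEFin; apply: eq_bigr => j _.
under eq_integral do rewrite EFinM.
rewrite ge0_integralZl//; last 2 first.
- by apply/measurable_EFinP; exact: measurable_indic.
- by rewrite lee_fin.
rewrite integral_indic//=.
rewrite setIidl; last first.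
  move=> s; rewrite /= !in_itv/= => /andP[h1 h2]; apply/andP; split.
    by rewrite (le_trans _ h1)// mulr_ge0// ltW.
  by rewrite (lt_le_trans h2)// ler_wpM2r ?ler_nat// ltW.
rewrite lebesgue_measure_itv/= lte_fin ltr_pM2r// ltr_nat ltnSn.
rewrite -EFinD -EFinM; congr (_%:E).
by rewrite -natr1; ring.
Qed.

End step_functions.

Section singular_integrable.
Context {R : realType}.
Notation mu := (@lebesgue_measure R).
Implicit Types (t s b c : R).

(** On a bounded interval exp (- s) is bounded below, so that Euler's integrand
   dominates. *)
Lemma powR_integrable b t : 0 < b -> 0 < t ->
  mu.-integrable `]0, t[ (EFin \o (fun s => s `^ (b - 1))).
Proof.
move=> b0 t0.
have h : mu.-integrable `]0, t[ (EFin \o (fun s => expR t * euler_integrand b s)).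
  apply: EFin_integrableZl => //.
  apply: (@integrableS _ _ _ mu `]0, +oo[) => //; last exact: euler_integrable.
  by apply: subset_itvl; rewrite bnd_simp.
apply: le_integrable h => //.
  by apply/measurable_EFinP; apply: measurable_funTS; exact: measurable_powR.
move=> s; rewrite /= in_itv/= => /andP[s0 st]; rewrite lee_fin.
rewrite !ger0_norm ?mulr_ge0 ?powR_ge0 ?expR_ge0//.
rewrite /euler_integrand mulrCA -expRD ler_peMr ?powR_ge0//.
by rewrite -[leLHS]expR0 ler_expR subr_ge0 ltW.
Qed.

Lemma is_derive_powR_reflect c t s : s < t ->
  is_derive s 1 (fun s => (t - s) `^ c) (- (c * (t - s) `^ (c - 1))).
Proof.
move=> st.
have d1 : is_derive s 1 (fun s : R => t - s) (- 1).
  by apply: is_derive_eq (is_deriveB (is_derive_cst t s 1) (is_derive_id s 1)) _; rewrite sub0r.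
have ts : 0 < t - s by rewrite subr_gt0.
have h := @is_derive1_comp R (fun y => y `^ c) (fun s => t - s) s _ _ (is_derive1_powR c ts) d1.
by apply: (is_derive_eq h); rewrite mulrN1.
Qed.

(** The singularity is at the right end: the intervals from 0 to t - t / (i + 2)
   exhaust, and the primitive is explicit. *)
Lemma powR_reflect_integrable c t : 0 < c -> 0 < t ->
  mu.-integrable `]0, t[ (EFin \o (fun s => (t - s) `^ (c - 1))).
Proof.
move=> c0 t0.
have mf D : measurable_fun D (fun s : R => (t - s) `^ (c - 1)).
  apply: measurable_funTS.
  apply: (measurableT_comp (measurable_powR (c - 1))).
  by apply: measurable_funB.
apply: (@integrableS _ _ _ mu `[0, t[) => //.
  by apply: subset_itvr; rewrite bnd_simp.
apply/integrableP; split; first by apply/measurable_EFinP; exact: mf.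
pose F (i : nat) := `[0, t - t / i.+2%:R]%classic.
have tF i : t / i.+2%:R < t by rewrite ltr_pdivrMr// ltr_pMr// ltr1n.
have UF : \bigcup_i F i = `[0, t[%classic.
  apply/seteqP; split => s /=.
    move=> [i _]; rewrite /F/= !in_itv/= => /andP[-> h]/=.
    by rewrite (le_lt_trans h)// gtrBl divr_gt0.
  rewrite in_itv/= => /andP[s0 st]; have ts : 0 < t - s by rewrite subr_gt0.
  exists (Num.truncn (t / (t - s))) => //; rewrite /F/= in_itv/= s0/=.
  rewrite lerBrDl -lerBrDr ler_pdivrMr// mulrC -ler_pdivrMr//.
  by rewrite (le_trans (ltW (truncnS_gt _)))// ler_nat.
rewrite (_ : (\int[mu]_(s in `[0%R, t[) _)%E =
             (\int[mu]_(s in \bigcup_i F i) ((t - s) `^ (c - 1))%:E)%E); last first.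
  by rewrite UF; apply: eq_integral => s _ /=; rewrite ger0_norm ?powR_ge0.
have cv : (fun i => \int[mu]_(s in F i) ((t - s) `^ (c - 1))%:E)%E @ \oo -->
    (\int[mu]_(s in \bigcup_i F i) ((t - s) `^ (c - 1))%:E)%E.
  apply: ge0_nondecreasing_set_cvg_integral.
  - apply/nondecreasing_seqP => i; rewrite subsetEset => s; rewrite /F/= !in_itv/=.
    move=> /andP[-> h2]/=; apply: (le_trans h2).
    by rewrite lerD2l lerN2 ler_pM2l// lef_pV2 ?posrE// ler_nat.
  - by move=> i; exact: measurable_itv.
  - by move=> i; apply/measurable_EFinP; exact: mf.
  - by move=> i s _; rewrite lee_fin powR_ge0.
apply: (@le_lt_trans _ _ (t `^ c / c)%:E); last by rewrite ltry.
rewrite -(cvg_lim _ cv)//; apply: lime_le; first by apply/cvg_ex; eexists; exact: cv.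
apply: nearW => i.
have ui0 : 0 < t - t / i.+2%:R by rewrite subr_gt0.
have dG s : s < t -> is_derive s 1 (fun s => - c^-1 * (t - s) `^ c) ((t - s) `^ (c - 1)).
  move=> st; apply: is_derive_eq (is_deriveZ (- c^-1) (is_derive_powR_reflect c st)) _.
  by rewrite /GRing.scale/= mulrNN mulrA mulVf ?mul1r// gt_eqF.
have Flt s : 0 <= s <= t - t / i.+2%:R -> s < t.
  by move=> /andP[_ /le_lt_trans]; apply; rewrite gtrBl divr_gt0.
rewrite /F (@continuous_FTC2 _ _ (fun s => - c^-1 * (t - s) `^ c) _ _ ui0).
- rewrite -EFinB lee_fin subr0 opprB addrCA subrr addr0 !mulNr opprK.
  by rewrite addrC mulrC gerBl mulr_ge0 ?powR_ge0// invr_ge0 ltW.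
- apply: within_itv_continuous => s /Flt st.
  exact: is_derive_continuous (is_derive_powR_reflect (c - 1) st).
- apply: derivable_LRcontinuous; first exact: ltW.
  by move=> s /Flt/dG; exact: is_derive_derivable.
- move=> s; rewrite in_itv/= => /andP[s0 su].
  by apply: is_derive_derive1; apply: dG; apply: Flt; rewrite !ltW.
Qed.

(** On each half of the interval only one of the two factors is singular. *)
Lemma abel_kernel_integrable b c t : 0 < b <= 1 -> 0 < c <= 1 -> 0 < t ->
  mu.-integrable `]0, t[ (EFin \o (fun s => (t - s) `^ (c - 1) * s `^ (b - 1))).
Proof.
move=> /andP[b0 b1] /andP[c0 c1] t0; have t20 : 0 < t / 2 by rewrite divr_gt0.
have h : mu.-integrable `]0, t[ (EFin \o (fun s =>
    (t / 2) `^ (c - 1) * s `^ (b - 1) + (t / 2) `^ (b - 1) * (t - s) `^ (c - 1))).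
  by apply: EFin_integrableD => //; apply: EFin_integrableZl => //;
    [exact: powR_integrable|exact: powR_reflect_integrable].
apply: le_integrable h => //.
  apply/measurable_EFinP; apply: measurable_funTS; apply: measurable_funM.
    apply: (measurableT_comp (measurable_powR (c - 1))).
    by apply: measurable_funB.
  exact: measurable_powR.
move=> s; rewrite /= in_itv/= => /andP[s0 st]; rewrite lee_fin.
rewrite !ger0_norm ?addr_ge0 ?mulr_ge0 ?powR_ge0//.
have [s2|s2] := leP s (t / 2).
  apply: (@le_trans _ _ ((t / 2) `^ (c - 1) * s `^ (b - 1))).
    by rewrite ler_wpM2r ?powR_ge0// powR_antitone//; lra.
  by rewrite lerDl mulr_ge0 ?powR_ge0.
apply: (@le_trans _ _ ((t / 2) `^ (b - 1) * (t - s) `^ (c - 1))).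
  by rewrite mulrC ler_wpM2r ?powR_ge0// powR_antitone// ltW.
by rewrite lerDr mulr_ge0 ?powR_ge0.
Qed.

End singular_integrable.

(** * Fractional integrals of Wright functions *)

Section riemann_nodes.
Context {R : realType}.
Variables (t s : R).
Hypotheses (s_gt0 : 0 < s) (s_lt : s < t).
Implicit Types (n A : nat).

Let t_gt0 : 0 < t. Proof. exact: lt_trans s_lt. Qed.

Definition mesh n : R := t / n.+1%:R.

Definition node n : nat := Num.truncn (s / mesh n).

Lemma mesh_gt0 n : 0 < mesh n.
Proof. by rewrite divr_gt0. Qed.

Lemma mesh_cvg0 : mesh @ \oo --> (0 : R).
Proof.
rewrite -[X in _ --> X](mulr0 t); apply: cvgM; [exact: cvg_cst|exact: cvg_harmonic].
Qed.

Lemma node_itv n : (node n)%:R * mesh n <= s < (node n).+1%:R * mesh n.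
Proof.
have /andP[h1 h2] : (node n)%:R <= s / mesh n < (node n).+1%:R.
  by apply: truncn_itv; rewrite divr_ge0 ?ltW ?mesh_gt0.
by rewrite -ler_pdivlMr ?mesh_gt0// -ltr_pdivrMr ?mesh_gt0// h1.
Qed.

Lemma node_le n : (node n <= n)%N.
Proof.
rewrite -ltnS truncn_lt_nat; last by rewrite divr_ge0 ?ltW ?mesh_gt0.
by rewrite ltr_pdivrMr ?mesh_gt0// mulrC divfK ?pnatr_eq0.
Qed.

Lemma conode_mesh n : (n - node n).+1%:R * mesh n = t - (node n)%:R * mesh n.
Proof.
have n0 : n.+1%:R != 0 :> R by rewrite pnatr_eq0.
rewrite -subSn ?node_le// natrB ?(leqW (node_le n))// mulrBl; congr (_ - _).
by rewrite mulrC divfK.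
Qed.

Lemma node_mesh_cvg : (node n).+1%:R * mesh n @[n --> \oo] --> s.
Proof.
apply: (@squeeze_cvgr _ _ _ _ (fun=> s) (fun n => s + mesh n)); last 2 first.
- exact: cvg_cst.
- by rewrite -[X in _ --> X]addr0; apply: cvgD; [exact: cvg_cst|exact: mesh_cvg0].
apply: nearW => n; have /andP[h1 h2] := node_itv n.
by rewrite (ltW h2)/= -natr1 mulrDl mul1r lerD2r.
Qed.

Lemma conode_mesh_cvg : (n - node n).+1%:R * mesh n @[n --> \oo] --> t - s.
Proof.
have -> : (fun n => (n - node n).+1%:R * mesh n) =
    (fun n => t - ((node n).+1%:R * mesh n - mesh n)).
  by apply/funext => n; rewrite conode_mesh -[in RHS]natr1 mulrDl mul1r addrK.
apply: cvgB; first exact: cvg_cst.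
rewrite -[X in _ --> X]subr0; apply: cvgB; [exact: node_mesh_cvg|exact: mesh_cvg0].
Qed.

Lemma index_cvgy (N : nat -> nat) (l : R) : 0 < l ->
  (N n).+1%:R * mesh n @[n --> \oo] --> l -> N @ \oo --> \oo.
Proof.
move=> l0 Nl; apply/cvgnyPge => A.
have h0 : A.+1%:R * mesh n @[n --> \oo] --> (0 : R).
  by rewrite -[X in _ --> X](mulr0 A.+1%:R); apply: cvgM; [exact: cvg_cst|exact: mesh_cvg0].
have l2 : l / 2 < l by rewrite ltr_pdivrMr// ltr_pMr// ltr1n.
near=> n.
have h1 : A.+1%:R * mesh n < l / 2.
  by near: n; apply: cvgr_lt h0 _ _; rewrite divr_gt0.
have h2 : l / 2 < (N n).+1%:R * mesh n by near: n; exact: cvgr_gt Nl _ l2.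
have := lt_trans h1 h2; rewrite ltr_pM2r ?mesh_gt0// ltr_nat ltnS; exact: ltnW.
Unshelve. all: by end_near. Qed.

End riemann_nodes.

Section abel_integral.
Context {R : realType}.
Notation mu := (@lebesgue_measure R).
Variable a : R.
Hypotheses (a_gt0 : 0 < a) (a_lt : a < 1 / 2).
Variables (b c xi t : R).
Hypotheses (ab : a <= b) (b1 : b <= 1) (c_gt0 : 0 < c) (c1 : c <= 1).
Hypotheses (xi_ge0 : 0 <= xi) (t_gt0 : 0 < t).
Implicit Types (s : R) (n j : nat).

Let b_gt0 : 0 < b. Proof. exact: lt_le_trans a_gt0 ab. Qed.
Let mesh_gt0' n : 0 < mesh t n. Proof. by rewrite divr_gt0. Qed.

(* The argument of the discrete Wright function at mesh width t / (n + 1). *)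
Let X n := xi * mesh t n `^ (- a).
Let v n j := (mesh t n `^ (c - 1) * negbin c (n - j)) *
             (mesh t n `^ (b - 1) * dwright a b j (X n)).

Let X_ge0 n : 0 <= X n. Proof. by rewrite mulr_ge0// powR_ge0. Qed.

Let v_ge0 n j : 0 <= v n j.
Proof.
rewrite !mulr_ge0 ?powR_ge0 ?negbin_ge0 ?(ltW c_gt0)// dwright_ge0//.
exact: ltW.
Qed.

Let kernel s := (t - s) `^ (c - 1) * s `^ (b - 1).

Lemma mesh_powR n (e : R) m : mesh t n `^ (e - 1) * m.+1%:R `^ (e - 1) =
  (m.+1%:R * mesh t n) `^ (e - 1).
Proof. by rewrite -powRM ?(ltW (mesh_gt0' n))// mulrC. Qed.

Let integral_step n :
  (\int[mu]_(s in `]0%R, t[) (step_fun (mesh t n) n.+1 (v n) s)%:E =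
   (t `^ (b + c - 1) * (n.+1%:R `^ (1 - (b + c)) * dwright a (b + c) n (X n)))%:E)%E.
Proof.
have n0 : n.+1%:R != 0 :> R by rewrite pnatr_eq0.
have th : n.+1%:R * mesh t n = t by rewrite mulrC divfK.
rewrite integral_itv_obnd_cbnd; last first.
  by apply/measurable_EFinP; exact: measurable_step_fun.
rewrite -{1}th integral_step_fun//; congr (_%:E).
have -> : \sum_(j < n.+1) v n j =
    mesh t n `^ (c - 1) * mesh t n `^ (b - 1) * dwright a (b + c) n (X n).
  by rewrite dwrightD// big_distrr/=; apply: eq_bigr => j _; rewrite /v; ring.
have hn0 : mesh t n != 0 by rewrite gt_eqF.
rewrite -powRD ?hn0 ?implybT// !mulrA; congr (_ * _).
rewrite -[X in X * _](powRr1 (ltW (mesh_gt0' n))) -powRD ?hn0 ?implybT//.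
have -> : 1 + (c - 1 + (b - 1)) = b + c - 1 by ring.
have -> : 1 - (b + c) = - (b + c - 1) by ring.
by rewrite -{2}th powRM// ?(ltW (mesh_gt0' n))// powRN mulrAC divff ?mul1r// gt_eqF// powR_gt0.
Qed.

Let integral_step_cvg :
  (fun n => \int[mu]_(s in `]0%R, t[) (step_fun (mesh t n) n.+1 (v n) s)%:E)%E @ \oo -->
  (t `^ (b + c - 1) * wrightN a (b + c) (xi * t `^ (- a)))%:E.
Proof.
under eq_fun do rewrite integral_step.
apply: cvg_EFin; first exact: nearW.
apply: cvgM; first exact: cvg_cst.
apply: (@dwright_cvg R a a_gt0 a_lt (b + c) id) => //.
rewrite (_ : (fun n => _) = fun=> xi * t `^ (- a)); first exact: cvg_cst.
apply/funext => n; rewrite /X -mulrA -powRM ?(ltW (mesh_gt0' n))//.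
by rewrite divfK// pnatr_eq0.
Qed.

(** The index j of the cell of s and the complementary index n - j both tend to
   infinity, with (j + 1) h -> s and (n - j + 1) h -> t - s for the mesh h; the
   two factors then have the scaling limits of [dwright_cvg] and
   [negbin_scaled_cvg]. *)
Let step_cvg s : 0 < s < t ->
  (fun n => step_fun (mesh t n) n.+1 (v n) s) @ \oo -->
  rgamma c * (t - s) `^ (c - 1) * (s `^ (b - 1) * wrightN a b (xi * s `^ (- a))).
Proof.
move=> /andP[s0 st].
have th n : n.+1%:R * mesh t n = t by rewrite mulrC divfK// pnatr_eq0.
have E n : step_fun (mesh t n) n.+1 (v n) s = v n (node t s n).
  by rewrite step_funE// th (ltW s0).
under eq_fun do rewrite E.
have ts0 : 0 < t - s by rewrite subr_gt0.
have c1s := node_mesh_cvg s0 st; have c2s := conode_mesh_cvg s0 st.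
have Joo := index_cvgy s0 st s0 c1s; have Koo := index_cvgy s0 st ts0 c2s.
have powR_cvg (u : nat -> R) (l e : R) : 0 < l -> u @ \oo --> l -> u n `^ e @[n --> \oo] --> l `^ e.
  by move=> l0 ul; exact: (cvg_comp _ _ ul (is_derive_continuous (is_derive1_powR e l0))).
apply: cvgM.
  have -> : (fun n => mesh t n `^ (c - 1) * negbin c (n - node t s n)) =
     fun n => negbin_scaled c (n - node t s n) * ((n - node t s n).+1%:R * mesh t n) `^ (c - 1).
    by apply/funext => n; rewrite negbin_unscale mulrA mesh_powR mulrC.
  apply: cvgM; last exact: powR_cvg.
  exact: (cvg_comp _ _ Koo (@negbin_scaled_cvg _ c)).
have -> : (fun n => mesh t n `^ (b - 1) * dwright a b (node t s n) (X n)) =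
   fun n => ((node t s n).+1%:R * mesh t n) `^ (b - 1) *
     ((node t s n).+1%:R `^ (1 - b) * dwright a b (node t s n) (X n)).
  apply/funext => n; rewrite -mesh_powR mulrA -[in RHS](mulrA (mesh t n `^ _)) -powRD.
    have -> : b - 1 + (1 - b) = 0 by ring.
    by rewrite powRr0 mulr1.
  by rewrite pnatr_eq0 implybT.
apply: cvgM; first exact: powR_cvg.
apply: dwright_cvg => //.
rewrite (_ : (fun n => _) = fun n => xi * ((node t s n).+1%:R * mesh t n) `^ (- a)).
  by apply: cvgM; [exact: cvg_cst|exact: powR_cvg].
by apply/funext => n; rewrite /X -mulrA -powRM ?(ltW (mesh_gt0' n))// [_ * mesh t n]mulrC.
Qed.

(** The discrete Wright function is largest at x = 0, where it is a negative
   binomial coefficient; (j + 1) h >= s and (n - j + 1) h >= t - s, and the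
   exponents are nonpositive. *)
Let step_dominated : exists C, forall s n, 0 < s < t ->
  `|step_fun (mesh t n) n.+1 (v n) s| <= C * kernel s.
Proof.
have bd (u : R) : exists2 C, 0 <= C & forall n, `|negbin_scaled u n| <= C.
  by eexists; last exact: negbin_scaled_norm_le; rewrite mulr_ge0 ?expR_ge0 ?powR_ge0.
have [C1 C10 hC1] := bd c; have [C2 C20 hC2] := bd b.
exists (C1 * C2) => s n /andP[s0 st].
have th : n.+1%:R * mesh t n = t by rewrite mulrC divfK// pnatr_eq0.
rewrite step_funE ?th ?(ltW s0)// -/(node t s n) ger0_norm//.
have /andP[h1 h2] := node_itv s0 st n.
rewrite /kernel [leRHS]mulrACA ler_pM//.
- by rewrite mulr_ge0 ?powR_ge0 ?negbin_ge0// ltW.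
- by rewrite mulr_ge0 ?powR_ge0 ?dwright_ge0// ltW.
- rewrite negbin_unscale mulrA mesh_powR mulrC ler_pM ?powR_ge0//.
  + by rewrite mulr_ge0 ?powR_ge0 ?negbin_ge0// ltW.
  + exact: le_trans (ler_norm _) (hC1 _).
  + by rewrite powR_antitone ?subr_gt0// conode_mesh// lerD2l lerN2.
apply: (@le_trans _ _ (mesh t n `^ (b - 1) * negbin b (node t s n))).
  rewrite ler_wpM2l ?powR_ge0// -(dwright0 a).
  apply: (nonincreasing_of_derive (X_ge0 n)
    (fun z _ => is_derive_dwright a_gt0 a_lt b (node t s n) z)) => z /andP[z0 _].
  by rewrite oppr_le0 dwright_ge0// subr_ge0.
rewrite negbin_unscale mulrA mesh_powR mulrC ler_pM ?powR_ge0//.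
- by rewrite mulr_ge0 ?powR_ge0 ?negbin_ge0// ltW.
- exact: le_trans (ler_norm _) (hC2 _).
- by rewrite powR_antitone// ltW.
Qed.

(** The fractional integral of order c turns b into b + c. The power series in xi
   cannot be integrated termwise, because s ^ (b - 1 - a k) is not integrable at
   0 for large k. Instead the integrand is the limit of step functions whose
   integrals are discrete convolutions, known in closed form by [dwrightD]. *)
Lemma abel_wrightN (k : R) :
  \int[mu]_(s in `[0, t])
    ((t - s) `^ (c - 1) * (k * (s `^ (b - 1) * wrightN a b (xi * s `^ (- a)))))
  = k * (Gamma c * (t `^ (b + c - 1) * wrightN a (b + c) (xi * t `^ (- a)))).
Proof.
pose g s := (t - s) `^ (c - 1) * (s `^ (b - 1) * wrightN a b (xi * s `^ (- a))).
have [C hC] := step_dominated.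
have mg : measurable_fun `]0, t[ g.
  apply: open_continuous_measurable_fun; first exact: interval_open.
  move=> s; rewrite inE/= in_itv/= => /andP[s0 st].
  have cp e := is_derive_continuous (is_derive1_powR e s0).
  suff : {for s, continuous g} by [].
  rewrite /g; apply: continuousM; first exact: is_derive_continuous (is_derive_powR_reflect (c - 1) st).
  apply: continuousM; first exact: cp.
  apply: continuous_comp; last exact: wrightN_continuous.
  by apply: continuousM; [exact: cst_continuous|exact: cp].
have mrg : measurable_fun `]0, t[ (EFin \o (fun s => rgamma c * g s)).
  by apply/measurable_EFinP; apply: measurable_funM.
have ik : mu.-integrable `]0, t[ (EFin \o (fun s => C * kernel s)).
  by apply: EFin_integrableZl => //; apply: abel_kernel_integrable; rewrite ?b_gt0 ?c_gt0.
have mstep n : measurable_fun `]0, t[ (EFin \o step_fun (mesh t n) n.+1 (v n)).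
  by apply/measurable_EFinP; exact: measurable_step_fun.
have cvstep : {ae mu, forall s, `]0, t[%classic s ->
    (EFin \o step_fun (mesh t n) n.+1 (v n)) s @[n --> \oo] -->
    (EFin \o (fun s => rgamma c * g s)) s}.
  apply: aeW => s; rewrite /= in_itv/= => st.
  by apply: cvg_EFin; [exact: nearW|rewrite /g mulrA; exact: step_cvg].
have domstep : {ae mu, forall s n, `]0, t[%classic s ->
    (`|(EFin \o step_fun (mesh t n) n.+1 (v n)) s| <= (EFin \o (fun s => (C * kernel s)%R)) s)%E}.
  by apply: aeW => s n; rewrite /= in_itv/= => st; rewrite lee_fin hC.
have mD : measurable (`]0, t[%classic : set R) by exact: measurable_itv.
have [irg _ cvI] := @dominated_convergence _ _ R mu _ mD _ _ _ mstep mrg cvstep ik domstep.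
have ig : mu.-integrable `]0, t[ (EFin \o g).
  have : mu.-integrable `]0, t[ (EFin \o (fun s => Gamma c * (rgamma c * g s))).
    exact: EFin_integrableZl.
  apply: eq_integrable => // s _ /=; rewrite /rgamma mulrA divff ?mul1r//.
  by rewrite gt_eqF// Gamma_gt0.
have E : \int[mu]_(s in `]0, t[) (rgamma c * g s) =
    t `^ (b + c - 1) * wrightN a (b + c) (xi * t `^ (- a)).
  by rewrite /Rintegral (cvg_unique _ cvI integral_step_cvg).
rewrite RintegralZl// in E.
under eq_Rintegral do rewrite mulrCA.
have -> : \int[mu]_(s in `[0, t]) (k * g s) = \int[mu]_(s in `]0, t[) (k * g s).
  have mkg : measurable_fun `]0, t[ (fun s => k * g s) by exact: measurable_funM.
  congr fine; rewrite integral_itv_obnd_cbnd; last exact/measurable_EFinP.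
  rewrite integral_itv_bndo_bndc//.
  by apply/measurable_EFinP/measurable_fun_itv_obnd_cbndP.
rewrite RintegralZl// -E /rgamma; congr (_ * _).
by rewrite mulrA divff ?mul1r// gt_eqF// Gamma_gt0.
Qed.

End abel_integral.

(** * The similarity solutions of the fractional heat equation *)

Section selfsimilar.
Context {R : realType}.
Variables (alpha lam : R).
Hypotheses (alpha_gt0 : 0 < alpha) (alpha_lt1 : alpha < 1) (lam_gt0 : 0 < lam).
Implicit Types (b x t z A K : R).
Local Notation a := (alpha / 2).
Local Notation W := (wrightN a).

Let a_gt0 : 0 < a. Proof. by rewrite divr_gt0. Qed.
Let a_lt : a < 1 / 2. Proof. by rewrite ltr_pM2r. Qed.

(** Every quantity attached to the similarity temperature is a multiple of one
   of these: the Laplace transform of selfsim b x in t is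
   s ^ (- b) exp (- (x / lam) s ^ a). *)
Definition selfsim b x t : R := t `^ (b - 1) * W b (x / lam * t `^ (- a)).

Lemma selfsim1 x t : selfsim 1 x t = W 1 (x / lam * t `^ (- a)).
Proof. by rewrite /selfsim subrr powRr0 mul1r. Qed.

Lemma selfsim_time0 b x : b != 1 -> selfsim b x 0 = 0.
Proof. by move=> b1; rewrite /selfsim powR0 ?mul0r// subr_eq0. Qed.

Lemma is_derive_selfsim_x b x t : 0 < t ->
  is_derive x 1 (fun y => selfsim b y t) (- lam^-1 * selfsim (b - a) x t).
Proof.
move=> t0.
have d1 : is_derive x 1 (fun y => y / lam * t `^ (- a)) (lam^-1 * t `^ (- a)).
  have := is_derive_mull (lam^-1 * t `^ (- a)) (is_derive_id x (1 : R)); rewrite mulr1.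
  have -> // : (fun y => lam^-1 * t `^ (- a) * id y) = (fun y => y / lam * t `^ (- a)).
  by apply/funext => y; rewrite /= mulrC mulrA.
have d2 := @is_derive1_comp R (W b) _ x _ _
  (is_derive_wrightN a_gt0 a_lt b (x / lam * t `^ (- a))) d1.
apply: (is_derive_eq (is_derive_mull (t `^ (b - 1)) d2)); rewrite /selfsim.
have -> : t `^ (b - a - 1) = t `^ (b - 1) * t `^ (- a).
  by rewrite -powRD ?(gt_eqF t0) ?implybT//; congr (_ `^ _); ring.
by ring.
Qed.

(** The chain rule gives (b - 1) W b + a y W (b - a) at y = x / lam t ^ (- a),
   which is W (b - 1) by the recurrence. *)
Lemma is_derive_selfsim_t b x t : 0 < t ->
  is_derive t 1 (selfsim b x) (selfsim (b - 1) x t).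
Proof.
move=> t0.
have d1 : is_derive t 1 (fun s => x / lam * s `^ (- a)) (x / lam * (- a * t `^ (- a - 1))).
  exact: is_derive_mull (is_derive1_powR (- a) t0).
have d2 := @is_derive1_comp R (W b) _ t _ _
  (is_derive_wrightN a_gt0 a_lt b (x / lam * t `^ (- a))) d1.
have d3 := is_deriveM (is_derive1_powR (b - 1) t0) d2.
apply: (is_derive_eq d3); rewrite /GRing.scale/= /selfsim.
rewrite (wrightN_rec a_gt0 a_lt b).
have E e : t `^ (e - 1) = t `^ e / t.
  by rewrite powRB ?(gt_eqF t0) ?implybT// powRr1// ltW.
rewrite !E; field; rewrite !gt_eqF//.
Qed.

Lemma selfsim_continuous2 b (p : R * R) : 0 < p.2 ->
  {for p, continuous (fun q : R * R => selfsim b q.1 q.2)}.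
Proof.
move=> p0; have cp e : {for p, continuous (fun q : R * R => q.2 `^ e)}.
  apply: (@continuous_comp _ _ _ snd (fun s => s `^ e)); first exact: cvg_snd.
  exact: is_derive_continuous (is_derive1_powR e p0).
apply: continuousM; first exact: cp.
apply: (@continuous_comp _ _ _ (fun q : R * R => q.1 / lam * q.2 `^ (- a)) (W b)).
  apply: continuousM; last exact: cp.
  by apply: continuousM; [exact: cvg_fst|exact: cst_continuous].
exact: wrightN_continuous.
Qed.

Lemma wright_sim_gt0 x t : 0 < t -> wright_sim alpha lam x t = selfsim 1 x t.
Proof.
move=> t0; rewrite /wright_sim gt_eqF// wrightE opprK selfsim1; congr (W 1 _).
by rewrite invfM mulrA powRN.
Qed.

Lemma wright_sim_time0 x : wright_sim alpha lam x 0 = 0.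
Proof.
rewrite /wright_sim eqxx; apply: cvg_lim => //.
have -> : (fun z => wright z (- a) 1) = (fun z => W 1 (- z)).
  by apply/funext => z; rewrite wrightE.
apply/cvgNy_compNP.
have -> : (fun z => W 1 (- z)) \o -%R = W 1 by apply/funext => z /=; rewrite opprK.
exact: wrightN_cvg0.
Qed.

Section affine.
Variables A K : R.

(** Both temperatures are of this form, with their own A, K and lam. *)
Definition affine_sim x t : R := A + K * wright_sim alpha lam x t.

Lemma affine_sim_gt0 x t : 0 < t -> affine_sim x t = A + K * selfsim 1 x t.
Proof. by move=> t0; rewrite /affine_sim wright_sim_gt0. Qed.

Lemma affine_sim_time0 x : affine_sim x 0 = A.
Proof. by rewrite /affine_sim wright_sim_time0 mulr0 addr0. Qed.

Let is_deriveAK (f : R -> R) z df : is_derive z 1 f df ->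
  is_derive z 1 (fun y => A + K * f y) (K * df).
Proof.
move=> d; have := is_deriveD (is_derive_cst A z 1) (is_derive_mull K d).
by move=> h; apply: (is_derive_eq h); rewrite add0r.
Qed.

(** At t = 0 the temperature is constant in x, and selfsim (1 - a) x 0 = 0 because
   0 ^ (- a) = 0: the formula holds there too. *)
Lemma is_derive_affine_sim_x x t : 0 <= t ->
  is_derive x 1 (fun y => affine_sim y t) (- (K / lam) * selfsim (1 - a) x t).
Proof.
rewrite le_eqVlt => /predU1P[<-|t0].
  have -> : (fun y => affine_sim y 0) = cst A.
    by apply/funext => y; rewrite affine_sim_time0.
  have a0 : 1 - a != 1 by rewrite -subr_eq0 addrAC subrr sub0r oppr_eq0 gt_eqF.
  rewrite selfsim_time0 // mulr0; exact: is_derive_cst.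
have -> : (fun y => affine_sim y t) = (fun y => A + K * selfsim 1 y t).
  by apply/funext => y; rewrite affine_sim_gt0.
by apply: (is_derive_eq (is_deriveAK (is_derive_selfsim_x 1 x t0))); ring.
Qed.

Lemma is_derive_affine_sim_t x t : 0 < t ->
  is_derive t 1 (affine_sim x) (K * selfsim 0 x t).
Proof.
move=> t0; have d := is_deriveAK (is_derive_selfsim_t 1 x t0).
rewrite subrr in d; apply: near_eq_is_derive d.
by near=> s; rewrite affine_sim_gt0//; near: s; exact: lt_nbhsr.
Unshelve. all: by end_near. Qed.

Lemma d_dx_affine_sim x t : 0 <= t ->
  d_dx affine_sim x t = - (K / lam) * selfsim (1 - a) x t.
Proof. by move=> t0; exact: is_derive_derive1 (is_derive_affine_sim_x x t0). Qed.

Lemma is_derive_d_dx_affine_sim x t : 0 < t ->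
  is_derive x 1 (fun y => d_dx affine_sim y t) (K / lam ^+ 2 * selfsim (1 - a - a) x t).
Proof.
move=> t0.
have -> : (fun y => d_dx affine_sim y t) = (fun y => - (K / lam) * selfsim (1 - a) y t).
  by apply/funext => y; rewrite d_dx_affine_sim// ltW.
apply: (is_derive_eq (is_derive_mull _ (is_derive_selfsim_x (1 - a) x t0))).
by field; rewrite gt_eqF.
Qed.

Lemma RL_int_affine_sim x t : 0 <= x -> 0 < t ->
  RL_int alpha (d_dx affine_sim) x t = - (K / lam) * selfsim (1 + a) x t.
Proof.
move=> x0 t0; rewrite /RL_int.
have h1 : a <= 1 - a by move: a_lt => ?; lra.
have h2 : 1 - a <= 1 by rewrite gerBl ltW.
have xi0 : 0 <= x / lam by rewrite divr_ge0// ltW.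
have E := abel_wrightN a_gt0 a_lt h1 h2 alpha_gt0 (ltW alpha_lt1) xi0 t0 (- (K / lam)).
have -> : \int[lebesgue_measure]_(s in `[0, t])
     ((t - s) `^ (alpha - 1) * d_dx affine_sim x s) =
   \int[lebesgue_measure]_(s in `[0, t]) ((t - s) `^ (alpha - 1) *
    (- (K / lam) * (s `^ (1 - a - 1) * W (1 - a) (x / lam * s `^ (- a))))).
  by apply: eq_Rintegral => s; rewrite inE/= in_itv/= => /andP[s0 _]; rewrite d_dx_affine_sim.
rewrite E.
have G0 : Gamma alpha != 0 by rewrite gt_eqF// Gamma_gt0.
rewrite mulrCA mulKf//; congr (_ * _); rewrite /selfsim.
by have -> : 1 - a + alpha = 1 + a by field.
Qed.

Lemma is_derive_RL_int_affine_sim x t : 0 <= x -> 0 < t ->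
  is_derive t 1 (RL_int alpha (d_dx affine_sim) x) (- (K / lam) * selfsim a x t).
Proof.
move=> x0 t0.
have d := is_derive_mull (- (K / lam)) (is_derive_selfsim_t (1 + a) x t0).
have E : 1 + a - 1 = a by ring.
rewrite E in d.
apply: near_eq_is_derive d.
by near=> s; rewrite RL_int_affine_sim//; near: s; exact: lt_nbhsr.
Unshelve. all: by end_near. Qed.

Lemma RL_D_affine_sim x t : 0 <= x -> 0 < t ->
  RL_D alpha (d_dx affine_sim) x t = - (K / lam) * selfsim a x t.
Proof. by move=> x0 t0; exact: is_derive_derive1 (is_derive_RL_int_affine_sim x0 t0). Qed.

Lemma has_RL_D_affine_sim x t : 0 <= x -> 0 < t -> has_RL_D alpha (d_dx affine_sim) x t.
Proof. by move=> x0 t0; exact: is_derive_derivable (is_derive_RL_int_affine_sim x0 t0). Qed.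

(** Both sides are the same multiple of selfsim 0. *)
Lemma affine_sim_pde x t : 0 < x -> 0 < t -> satisfies_pde alpha lam affine_sim x t.
Proof.
move=> x0 t0.
have d : is_derive x 1 (fun y => RL_D alpha (d_dx affine_sim) y t)
    (K / lam ^+ 2 * selfsim 0 x t).
  have E : - (K / lam) * (- lam^-1 * selfsim (a - a) x t) = K / lam ^+ 2 * selfsim 0 x t.
    by rewrite subrr; field; rewrite gt_eqF.
  have d := is_derive_mull (- (K / lam)) (is_derive_selfsim_x a x t0).
  rewrite E in d.
  apply: near_eq_is_derive d; near=> y.
  by rewrite RL_D_affine_sim// ltW//; near: y; exact: lt_nbhsr.
split.
- exact: is_derive_derivable (is_derive_affine_sim_t x t0).
- by near=> y; apply: has_RL_D_affine_sim => //; apply: ltW; near: y; exact: lt_nbhsr.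
- exact: is_derive_derivable d.
- rewrite [LHS](is_derive_derive1 (is_derive_affine_sim_t x t0)).
  rewrite [d_dx _ _ _](is_derive_derive1 d).
  by field; exact: lt0r_neq0.
Unshelve. all: by end_near. Qed.

Lemma RL_D_affine_sim_cvg (F : set_system R) x t : Filter F -> 0 < x -> 0 < t ->
  F --> x -> RL_D alpha (d_dx affine_sim) y t @[y --> F] --> - (K / lam) * selfsim a x t.
Proof.
move=> FF x0 t0 Fx.
have c : - (K / lam) * selfsim a y t @[y --> F] --> - (K / lam) * selfsim a x t.
  apply: cvgM; first exact: cvg_cst.
  exact: (cvg_comp _ _ Fx (is_derive_continuous (is_derive_selfsim_x a x t0))).
apply: cvg_trans c; apply: near_eq_cvg.
have : \forall y \near F, 0 < y by apply: Fx; exact: lt_nbhsr.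
by apply: filterS => y /ltW y0; rewrite RL_D_affine_sim.
Qed.

Lemma affine_sim_continuous2 (p : R * R) : 0 < p.2 ->
  {for p, continuous (fun q : R * R => affine_sim q.1 q.2)}.
Proof.
move=> p0.
have h : (fun q : R * R => A + K * selfsim 1 q.1 q.2) @ p --> A + K * selfsim 1 p.1 p.2.
  apply: cvgD; first exact: cvg_cst.
  by apply: cvgM; [exact: cvg_cst|exact: selfsim_continuous2].
suff : (fun q : R * R => affine_sim q.1 q.2) @ p --> affine_sim p.1 p.2 by [].
rewrite (affine_sim_gt0 _ p0); apply: cvg_trans h; apply: near_eq_cvg.
have := near_snd_gt0 p0.
by apply: filterS => q q0; rewrite affine_sim_gt0.
Qed.

Lemma affine_sim_continuous_in2 (D : set (R * R)) : (forall p, D p -> 0 < p.2) ->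
  continuous_in2 D affine_sim.
Proof.
move=> D0; apply: continuous_in_subspaceT => p; rewrite inE => /D0.
exact: affine_sim_continuous2.
Qed.

Lemma affine_sim_C2 (D : set (R * R)) : (forall p, D p -> 0 < p.2) -> C2_x D affine_sim.
Proof.
move=> D0; split => [p /D0 p0|].
  split; first exact: is_derive_derivable (is_derive_affine_sim_x p.1 (ltW p0)).
  exact: is_derive_derivable (is_derive_d_dx_affine_sim p.1 p0).
have cont (f : R -> R -> R) (c b : R) :
    (forall x t, 0 < t -> f x t = c * selfsim b x t) -> continuous_in2 D f.
  move=> fE; apply: continuous_in_subspaceT => p; rewrite inE => /D0 p0.
  have h : (fun q : R * R => c * selfsim b q.1 q.2) @ p --> c * selfsim b p.1 p.2.
    by apply: cvgM; [exact: cvg_cst|exact: selfsim_continuous2].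
  suff : (fun q : R * R => f q.1 q.2) @ p --> f p.1 p.2 by [].
  rewrite (fE _ _ p0); apply: cvg_trans h; apply: near_eq_cvg.
  have := near_snd_gt0 p0.
  by apply: filterS => q q0; rewrite fE.
split.
  by apply: (cont _ (- (K / lam)) (1 - a)) => x t /ltW; exact: d_dx_affine_sim.
apply: (cont _ (K / lam ^+ 2) (1 - a - a)) => x t t0.
exact: is_derive_derive1 (is_derive_d_dx_affine_sim x t0).
Qed.

End affine.
End selfsimilar.

(** * Behaviour at the origin and absolute continuity *)

Section origin.
Context {R : realType}.
Implicit Types (m M : R) (A : set (R * R)) (u : R -> R -> R).

Lemma bounded_at_originP m M A u :
  (forall p, A p -> m <= u p.1 p.2 <= M) ->
  (forall V : set (R * R), nbhs ((0, 0) : R * R) V -> exists2 p, A p & V p) ->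
  bounded_at_origin m A u.
Proof.
move=> uA A0; rewrite /bounded_at_origin limf_einfE limf_esupE.
have FA : within A (nbhs ((0, 0) : R * R)) A by apply: nearW.
split; last split.
- apply: le_ereal_sup_tmp; exists (ereal_inf [set (u p.1 p.2)%:E | p in A]).
    by exists A.
  by apply: le_ereal_inf_tmp => _ [p /uA/andP[h _] <-]; rewrite lee_fin.
- apply: ge_ereal_sup => _ [V FV <-]; apply: le_ereal_inf_tmp => _ [V' FV' <-].
  have [p Ap /(_ Ap)[Vp Vp']] := A0 _ (filterI FV FV').
  apply: (@le_trans _ _ (u p.1 p.2)%:E).
    by apply: ereal_inf_lbound; exists p.
  by apply: ereal_sup_ubound; exists p.
- apply: (@le_lt_trans _ _ M%:E); last by rewrite ltry.
  apply: (@le_trans _ _ (ereal_sup [set (u p.1 p.2)%:E | p in A])).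
    by apply: ereal_inf_lbound; exists A.
  by apply: ge_ereal_sup => _ [p /uA/andP[_ h] <-]; rewrite lee_fin.
Qed.

(** A curve inside A that tends to the origin shows that the filter of
   neighborhoods of the origin in A is proper. *)
Lemma curve_meets (A : set (R * R)) (g : R -> R) (T : R) : 0 < T ->
  g t @[t --> 0^'+] --> 0 -> (forall t, 0 < t <= T -> A (g t, t)) ->
  forall V : set (R * R), nbhs ((0, 0) : R * R) V -> exists2 p, A p & V p.
Proof.
move=> T0 g0 gA V V0.
have h : (g t, t) @[t --> 0^'+] --> ((0, 0) : R * R).
  have hid : (fun t : R => t) @ 0^'+ --> (0 : R) by apply: cvg_at_right_filter; exact: cvg_id.
  exact: (cvg_pair g0 hid).
have hV : \forall t \near 0^'+, V (g t, t) by exact: h.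
near (0 : R)^'+ => t.
exists (g t, t); last by near: t; exact: hV.
apply: gA; apply/andP; split; first by near: t; exact: nbhs_right_gt.
by near: t; exact: nbhs_right_le.
Unshelve. all: by end_near. Qed.

End origin.

Section lipschitz.
Context {R : realType}.

Lemma lipschitz_abs_cont (I : set R) (f : R -> R) (L : R) : 0 <= L ->
  (forall s t, I s -> I t -> s <= t -> `|f t - f s| <= L * (t - s)) -> abs_cont I f.
Proof.
move=> L0 fL e e0; have L10 : 0 < L + 1 by rewrite ltr_wpDl.
exists (e / (L + 1)); first by rewrite divr_gt0.
move=> n u v Iuv _ small.
have sum0 : 0 <= \sum_(i < n) (v i - u i).
  by apply: sumr_ge0 => i _; have [h _ _] := Iuv i; rewrite subr_ge0.
apply: (@le_lt_trans _ _ (L * \sum_(i < n) (v i - u i))).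
  rewrite big_distrr/=; apply: ler_sum => i _; have [h1 h2 h3] := Iuv i.
  exact: fL.
apply: (@le_lt_trans _ _ ((L + 1) * \sum_(i < n) (v i - u i))).
  by rewrite ler_wpM2r// lerDl.
by rewrite mulrC -ltr_pdivlMr.
Qed.

Variables (alpha lam : R).
Hypotheses (alpha_gt0 : 0 < alpha) (alpha_lt1 : alpha < 1) (lam_gt0 : 0 < lam).
Local Notation a := (alpha / 2).
Local Notation W := (wrightN a).

Let a_gt0 : 0 < a. Proof. by rewrite divr_gt0. Qed.
Let a_lt : a < 1 / 2. Proof. by rewrite ltr_pM2r. Qed.

(** As t tends to 0 the argument tends to infinity, where W decreases faster
   than any power; this outweighs t ^ (- a - 1). *)
Lemma wrightN_weight_bounded b x : 0 < x -> exists2 L, 0 <= L &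
  forall z, 0 < z -> z `^ (- a - 1) * `|W b (x / lam * z `^ (- a))| <= L.
Proof.
move=> x0; have xi0 : 0 < x / lam by rewrite divr_gt0.
(* The power y ^ n of the argument y supplies z ^ (- a n), which is at least
   z ^ (- a - 1) for z <= 1 as soon as a n >= a + 1. *)
pose n := (Num.truncn (a^-1 * (a + 1))).+1.
have hn : a + 1 <= a * n%:R.
  by rewrite -(ler_pdivrMl _ _ a_gt0); exact: ltW (truncnS_gt _).
have [C hC] := wrightN_decay a_gt0 a_lt b n.
have [C' hC'] := wrightN_decay a_gt0 a_lt b 0.
have C0 : 0 <= C by apply: le_trans (hC 1 ltr01); rewrite mulr_ge0// exprn_ge0.
have C'0 : 0 <= C' by apply: le_trans (hC' 1 ltr01); rewrite mulr_ge0// exprn_ge0.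
have xin0 : 0 < (x / lam) ^+ n by rewrite exprn_gt0.
exists (C / (x / lam) ^+ n + C') => [|z z0].
  by rewrite addr_ge0// divr_ge0// ltW.
have y0 : 0 < x / lam * z `^ (- a) by rewrite mulr_gt0// powR_gt0.
have [z1|/ltW z1] := leP z 1.
  apply: (@le_trans _ _ (C / (x / lam) ^+ n)); last by rewrite lerDl.
  rewrite ler_pdivlMr// (le_trans _ (hC _ y0))//.
  rewrite [leLHS]mulrAC ler_wpM2r// (exprMn _ (x / lam)) [leLHS]mulrC ler_wpM2l ?(ltW xin0)//.
  rewrite -powR_mulrn ?powR_ge0// -powRrM ger_powR ?z0//.
  by rewrite mulNr -opprD lerN2.
apply: (@le_trans _ _ C'); last by rewrite lerDr divr_ge0// ltW.
rewrite (le_trans _ (hC' _ y0))// expr0 ler_wpM2r//.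
rewrite -[leRHS](powRr0 z) ler_powR//; move: a_gt0 => ?; lra.
Qed.

(** The time derivative selfsim (- a) is bounded, and so is the slope of the chord
   from 0, selfsim (1 - a) x t / t. *)
Lemma selfsim_lipschitz x : 0 < x -> exists2 L, 0 <= L &
  forall s t, 0 <= s -> 0 <= t -> s <= t ->
    `|selfsim alpha lam (1 - a) x t - selfsim alpha lam (1 - a) x s| <= L * (t - s).
Proof.
move=> x0.
have [L1 L10 h1] := wrightN_weight_bounded (- a) x0.
have [L2 L20 h2] := wrightN_weight_bounded (1 - a) x0.
exists (L1 + L2) => [|s t s0 t0 st]; first exact: addr_ge0.
have [->|sn0] := eqVneq s 0.
  have a1 : 1 - a != 1 by rewrite -subr_eq0 addrAC subrr sub0r oppr_eq0 gt_eqF.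
  rewrite selfsim_time0// !subr0; have [->|tn0] := eqVneq t 0.
    by rewrite selfsim_time0// normr0 mulr0.
  have tp : 0 < t by rewrite lt0r tn0.
  apply: (@le_trans _ _ (L2 * t)); last by rewrite ler_wpM2r// lerDr.
  rewrite -ler_pdivrMr// (le_trans _ (h2 t tp))// /selfsim normrM (ger0_norm (powR_ge0 _ _)).
  rewrite mulrAC ler_wpM2r//.
  have -> : 1 - a - 1 = - a by ring.
  by rewrite powRB ?(gt_eqF tp) ?implybT// powRr1.
have sp : 0 < s by rewrite lt0r sn0.
have d z : s <= z <= t -> is_derive z 1 (selfsim alpha lam (1 - a) x) (selfsim alpha lam (- a) x z).
  move=> /andP[sz _]; have zp := lt_le_trans sp sz.
  apply: (is_derive_eq (is_derive_selfsim_t alpha_gt0 alpha_lt1 lam_gt0 (1 - a) x zp)).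
  by congr (selfsim _ _ _ _ _); ring.
have [z /andP[sz zt] ->] := mean_value st d.
rewrite normrM (@ger0_norm _ (t - s)) ?subr_ge0// ler_wpM2r ?subr_ge0//.
apply: (@le_trans _ _ L1); last by rewrite lerDl.
rewrite /selfsim normrM (ger0_norm (powR_ge0 _ _)); apply: h1; exact: lt_le_trans sz.
Qed.

Lemma affine_sim_abs_cont (I : set R) A K x : (forall t, I t -> 0 <= t) -> 0 < x ->
  abs_cont I (d_dx (affine_sim alpha lam A K) x).
Proof.
move=> I0 x0; have [L L0 hL] := selfsim_lipschitz x0.
apply: (@lipschitz_abs_cont _ _ (`|K / lam| * L)) => [|s t /I0 s0 /I0 t0 st].
  by rewrite mulr_ge0.
rewrite !d_dx_affine_sim// -mulrBr normrM normrN -mulrA ler_wpM2l//.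
exact: hL.
Qed.

End lipschitz.

(** * The equation for eta *)

Section eta.
Context {R : realType}.
Variable alpha : R.
Hypotheses (alpha_gt0 : 0 < alpha) (alpha_lt1 : alpha < 1).
Local Notation a := (alpha / 2).
Local Notation W := (wrightN a).
Implicit Types x y : R.

Let a_gt0 : 0 < a. Proof. by rewrite divr_gt0. Qed.
Let a_lt : a < 1 / 2. Proof. by rewrite ltr_pM2r. Qed.

Lemma G2E x : G2 alpha x = a^-1 * (W a x / (1 - W 1 x)).
Proof. by rewrite /G2 !wrightE opprK invf_div mulrA. Qed.

(** The recurrence at b = 1 + a absorbs the right-hand side of the equation for
   eta into G1. *)
Lemma G1E x : 0 <= x -> G1 alpha x + x = a^-1 * (W a x / W 1 x).
Proof.
move=> x0; rewrite /G1 !wrightE opprK (wrightN_aE a_gt0 a_lt).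
have := lt0r_neq0 (wrightN1_gt0 a_gt0 a_lt x0); have := lt0r_neq0 alpha_gt0.
by move=> h1 h2; field; rewrite h1 h2.
Qed.

Let p y := W a y / (1 - W 1 y).
Let q y := W a y / W 1 y.

Let p_continuous y : 0 < y -> {for y, continuous p}.
Proof.
move=> y0; apply: continuousM; first exact: wrightN_continuous.
apply: continuousV; first by rewrite gt_eqF// subr_gt0 wrightN1_lt1.
by apply: continuousB; [exact: cst_continuous|exact: wrightN_continuous].
Qed.

Let q_continuous y : 0 < y -> {for y, continuous q}.
Proof.
move=> y0; apply: continuousM; first exact: wrightN_continuous.
apply: continuousV; last exact: wrightN_continuous.
by rewrite gt_eqF// wrightN1_gt0// ltW.
Qed.

Let p_ge0 y : 0 < y -> 0 <= p y.
Proof.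
by move=> y0; rewrite divr_ge0 ?wrightN_ge0 ?subr_ge0 ?wrightN1_le1// ltW.
Qed.

Let q_ge0 y : 0 <= y -> 0 <= q y.
Proof. by move=> y0; rewrite divr_ge0 ?wrightN_ge0// ltW. Qed.

Variables (A B C lam : R).
Hypotheses (A_gt0 : 0 < A) (B_gt0 : 0 < B) (C_gt0 : 0 < C) (lam_gt0 : 0 < lam).

Let H x := A / a * p (2 * lam * x) - B / a * q (2 * x) - C * (2 * x).

(** In terms of p and q the unknown occurs in three monotone terms. *)
Let HE x : 0 < x -> A * G2 alpha (2 * lam * x) - B * G1 alpha (2 * x) = (C + B) * (2 * x)
  <-> H x = 0.
Proof.
move=> x0.
have x2 : 0 <= 2 * x by rewrite mulr_ge0// ltW.
have -> : G1 alpha (2 * x) = a^-1 * q (2 * x) - 2 * x by rewrite -G1E// addrK.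
rewrite G2E /H -/(p _) -!mulrA; split => h; lra.
Qed.

Let H_decreasing x y : 0 < x -> x < y -> H y < H x.
Proof.
move=> x0 xy.
have lx0 : 0 < 2 * lam * x by rewrite !mulr_gt0.
have h1 : p (2 * lam * y) <= p (2 * lam * x).
  by apply: flux_ratio_nonincreasing => //; rewrite ler_pM2l ?mulr_gt0// ltW.
have h2 : q (2 * x) <= q (2 * y).
  by apply: flux_ratio_nondecreasing => //; [rewrite mulr_ge0// ltW|rewrite ler_pM2l// ltW].
have h3 : A / a * p (2 * lam * y) <= A / a * p (2 * lam * x).
  by rewrite ler_wpM2l// divr_ge0 ?ltW.
have h4 : B / a * q (2 * x) <= B / a * q (2 * y).
  by rewrite ler_wpM2l// divr_ge0 ?ltW.
have h5 : C * (2 * x) < C * (2 * y) by rewrite ltr_pM2l// ltr_pM2l.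
rewrite /H; lra.
Qed.

Let H_continuous x : 0 < x -> {for x, continuous H}.
Proof.
move=> x0; have m (c : R) : {for x, continuous (fun x => c * x)}.
  by apply: continuousM; [exact: cst_continuous|exact: cvg_id].
apply: continuousB; last by apply: continuousM; [exact: cst_continuous|exact: m].
apply: continuousB; (apply: continuousM; first exact: cst_continuous).
  apply: (@continuous_comp _ _ _ (fun x => 2 * lam * x) p); first exact: m.
  by apply: p_continuous; rewrite !mulr_gt0.
apply: (@continuous_comp _ _ _ (fun x => 2 * x) q); first exact: m.
by apply: q_continuous; rewrite mulr_gt0.
Qed.

(** Near 0 the term in p is unbounded, as W a 0 = 1 / Gamma a > 0 and
   W 1 0 = 1. *)
Let H_pos : exists2 x, 0 < x <= 1 / 2 & 0 < H x.
Proof.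
(* For x <= 1 / 2 the two negative terms amount to at most A / a times Q. *)
pose Q := (B / a * q 1 + C) / (A / a).
have Aa0 : 0 < A / a by rewrite divr_gt0.
have Ba0 : 0 < B / a by rewrite divr_gt0.
pose g y := W a y - Q * (1 - W 1 y).
have g0 : 0 < g 0 by rewrite /g !wrightN0 rgamma1 subrr mulr0 subr0 rgamma_gt0.
have cg : {for 0, continuous g}.
  apply: continuousB; first exact: wrightN_continuous.
  apply: continuousM; first exact: cst_continuous.
  by apply: continuousB; [exact: cst_continuous|exact: wrightN_continuous].
have [d /= d0 hd] := cvgr_gt _ cg _ g0.
pose x := Num.min (1 / 2) (d / (4 * lam)).
have l40 : 0 < 4 * lam by rewrite mulr_gt0.
have x0 : 0 < x by rewrite lt_min !divr_gt0.
have x12 : x <= 1 / 2 by rewrite ge_min lexx.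
exists x; first by rewrite x0.
have lx0 : 0 < 2 * lam * x by rewrite !mulr_gt0.
have gx : 0 < g (2 * lam * x).
  apply: hd; rewrite /= sub0r normrN gtr0_norm//.
  have : x <= d / (4 * lam) by rewrite ge_min lexx orbT.
  rewrite ler_pdivlMr// => h; lra.
have W1 : 0 < 1 - W 1 (2 * lam * x) by rewrite subr_gt0 wrightN1_lt1.
have h1 : Q < p (2 * lam * x) by rewrite /p ltr_pdivlMr// -subr_gt0.
have h2 : q (2 * x) <= q 1.
  by apply: flux_ratio_nondecreasing => //; [rewrite mulr_ge0// ltW|lra].
have h3 : B / a * q 1 + C < A / a * p (2 * lam * x) by rewrite [ltRHS]mulrC -ltr_pdivrMr.
have h4 : B / a * q (2 * x) <= B / a * q 1 by rewrite ler_pM2l.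
have h5 : C * (2 * x) <= C by rewrite ler_piMr ?(ltW C_gt0)//; lra.
rewrite /H; lra.
Qed.

Let H_neg : exists2 x, 1 / 2 <= x & H x < 0.
Proof.
have Aa0 : 0 < A / a by rewrite divr_gt0.
have Ba0 : 0 < B / a by rewrite divr_gt0.
have l20 : 0 < 2 * lam by rewrite mulr_gt0.
pose P := A / a * p (2 * lam).
have P0 : 0 <= P by rewrite mulr_ge0 ?p_ge0// ltW.
(* For x >= 1 the term in p is at most P, and the linear term is 2 C + 2 P here. *)
pose x := 1 + P / C; have x1 : 1 <= x by rewrite lerDl divr_ge0// ltW.
exists x; first by lra.
have x0 : 0 < x by lra.
have h1 : A / a * p (2 * lam * x) <= P.
  rewrite ler_pM2l//; apply: flux_ratio_nonincreasing => //.
  by rewrite ler_peMr// ltW.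
have h2 : 0 <= B / a * q (2 * x).
  by rewrite mulr_ge0 ?q_ge0 ?(ltW Ba0)// mulr_ge0// ltW.
have h3 : C * (2 * x) = 2 * C + 2 * P by rewrite /x; field; rewrite gt_eqF.
rewrite /H h3; move: C_gt0 => ?; lra.
Qed.

Lemma eta_exists_unique : exists2 eta, 0 < eta &
  (A * G2 alpha (2 * lam * eta) - B * G1 alpha (2 * eta) = (C + B) * (2 * eta)) /\
  (forall y, 0 < y ->
    A * G2 alpha (2 * lam * y) - B * G1 alpha (2 * y) = (C + B) * (2 * y) -> y = eta).
Proof.
have [x1 /andP[x10 x1h] Hx1] := H_pos; have [x2 x2h Hx2] := H_neg.
have x12 : x1 <= x2 := le_trans x1h x2h.
have [eta] : exists2 c, c \in `[x1, x2] & H c = 0.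
  apply: IVT => //.
    apply: within_itv_continuous => z /andP[h _]; apply: H_continuous.
    exact: lt_le_trans h.
  by rewrite ge_min le_max (ltW Hx1) (ltW Hx2) orbT.
rewrite in_itv/= => /andP[h1 _] He; have e0 := lt_le_trans x10 h1.
exists eta => //; split; first exact/HE.
move=> y y0 /(HE y0) Hy; have [ye|ey|//] := ltgtP y eta.
  by have := H_decreasing y0 ye; rewrite He Hy ltxx.
by have := H_decreasing e0 ey; rewrite He Hy ltxx.
Qed.

End eta.

(** * The explicit solution *)

(** The equation for eta, with G1 and G2 expressed by the fluxes p1 and p2 and
   multiplied by a l1 s, is the Stefan condition at the time where
   t ^ (a - 1) = s. *)
Lemma stefan_balance {R : realType} (a l1 l2 k1 k2 d1 d2 m1 m2 p1 p2 s : R) :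
  a != 0 -> l1 != 0 -> l2 != 0 -> m1 != 0 -> m2 != 0 ->
  a^-1 * (k2 * d2 / (l1 * l2) * (p2 / m2) - k1 * d1 / l1 ^+ 2 * (p1 / m1)) * (a * l1 * s) =
  k1 * (- (d1 / m1 / l1) * (s * p1)) - k2 * (- (d2 / m2 / l2) * (s * p2)).
Proof. by move=> ? ? ? ? ?; field; do !(apply/andP; split). Qed.

Unset Implicit Arguments.
Theorem theorem2 (R : realType)
    (alpha T rho l c1 c2 k1 k2 mu lam1 lam2 Ui Um U0 : R) :
  0 < alpha < 1 -> 0 < T ->
  0 < rho -> 0 < l -> 0 < c1 -> 0 < c2 -> 0 < k1 -> 0 < k2 -> 0 < mu ->
  Ui < Um -> Um < U0 ->
  0 < lam1 -> lam1 ^+ 2 = k1 / (rho * c1) ->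
  0 < lam2 -> lam2 ^+ 2 = k2 / (rho * c2) ->
  let lam_a1 := lam1 * Num.sqrt mu in
  let lam_a2 := lam2 * Num.sqrt mu in
  let k_a1 := k1 * mu in
  let k_a2 := k2 * mu in
  let lam := lam_a1 / lam_a2 in
  let eta_equation (x : R) :=
    k_a2 * (U0 - Um) / (lam_a1 * lam_a2) * G2 alpha (2 * lam * x)
    - k_a1 * (Um - Ui) / lam_a1 ^+ 2 * G1 alpha (2 * x)
    = (rho * l + k_a1 * (Um - Ui) / lam_a1 ^+ 2) * (2 * x) in
  let w2 (eta x t : R) :=
    U0 - (U0 - Um) / (1 - wright (- (2 * eta * lam)) (- (alpha / 2)) 1)
         * (1 - wright_sim alpha lam_a2 x t) in
  let w1 (eta x t : R) :=
    Ui + (Um - Ui) / wright (- (2 * eta)) (- (alpha / 2)) 1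
         * wright_sim alpha lam_a1 x t in
  let r (eta t : R) := 2 * eta * lam_a1 * t `^ (alpha / 2) in
  exists eta : R,
    [/\ 0 < eta,
        eta_equation eta,
        forall y : R, 0 < y -> eta_equation y -> y = eta
      & is_solution alpha T rho l lam_a1 lam_a2 k_a1 k_a2 Ui Um U0
          (Num.min 0 Ui) (w1 eta) (w2 eta) (r eta)].
Proof.
move=> /andP[al0 al1] T0 rho0 l0 _ _ k10 k20 mu0 UiUm UmU0 lam10 _ lam20 _.
move=> lam_a1 lam_a2 k_a1 k_a2 lam eta_equation w2 w1 r.
pose a := alpha / 2; have a0 : 0 < a by rewrite divr_gt0.
have a_lt : a < 1 / 2 by rewrite ltr_pM2r.
have sq0 : 0 < Num.sqrt mu by rewrite sqrtr_gt0.
have L1 : 0 < lam_a1 by rewrite mulr_gt0.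
have L2 : 0 < lam_a2 by rewrite mulr_gt0.
have lam0 : 0 < lam by rewrite divr_gt0.
have ka1 : 0 < k_a1 by rewrite mulr_gt0.
have ka2 : 0 < k_a2 by rewrite mulr_gt0.
have D1 : 0 < Um - Ui by rewrite subr_gt0.
have D2 : 0 < U0 - Um by rewrite subr_gt0.
pose A := k_a2 * (U0 - Um) / (lam_a1 * lam_a2).
pose B := k_a1 * (Um - Ui) / lam_a1 ^+ 2.
have A0 : 0 < A by rewrite !divr_gt0 ?mulr_gt0.
have B0 : 0 < B by rewrite divr_gt0 ?mulr_gt0 ?exprn_gt0.
have C0 : 0 < rho * l by rewrite mulr_gt0.
have [eta eta0 [Heta uniq]] := eta_exists_unique al0 al1 A0 B0 C0 lam0.
exists eta; split; [exact: eta0|exact: Heta|exact: uniq|].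
pose W := wrightN a.
pose M1 := W 1 (2 * eta); pose M2 := W 1 (2 * eta * lam).
pose K1 := (Um - Ui) / M1; pose K2 := (U0 - Um) / (1 - M2).
have e2 : 0 < 2 * eta by rewrite mulr_gt0.
have el0 : 0 < 2 * eta * lam by rewrite mulr_gt0.
have M10 : 0 < M1 by apply: wrightN1_gt0 => //; exact: ltW.
have M20 : 0 < 1 - M2 by rewrite subr_gt0; exact: wrightN1_lt1.
have K10 : 0 < K1 by rewrite divr_gt0.
have K20 : 0 < K2 by rewrite divr_gt0.
have -> : w1 eta = affine_sim alpha lam_a1 Ui K1.
  by rewrite /w1 /affine_sim /K1 /M1 wrightE opprK.
have -> : w2 eta = affine_sim alpha lam_a2 (U0 - K2) K2.
  apply/funext => x; apply/funext => t.
  by rewrite /w2 /affine_sim /K2 /M2 wrightE opprK; ring.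
have r0 t : 0 < t -> 0 < r eta t by move=> t0; rewrite !mulr_gt0 ?powR_gt0.
have ry1 t : 0 < t -> r eta t / lam_a1 * t `^ (- a) = 2 * eta.
  move=> t0; rewrite /r -/a powRN; have := lt0r_neq0 (powR_gt0 a t0).
  by move: (t `^ a) => s s0; field; rewrite s0 lt0r_neq0.
have ry2 t : 0 < t -> r eta t / lam_a2 * t `^ (- a) = 2 * eta * lam.
  move=> t0; rewrite /r /lam -/a powRN; have := lt0r_neq0 (powR_gt0 a t0).
  by move: (t `^ a) => s s0; field; rewrite s0 lt0r_neq0.
have w2E x t : 0 < t -> affine_sim alpha lam_a2 (U0 - K2) K2 x t =
    U0 - K2 * (1 - W 1 (x / lam_a2 * t `^ (- a))).
  by move=> t0; rewrite affine_sim_gt0// selfsim1 -/W; ring.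
have w1E x t : 0 < t -> affine_sim alpha lam_a1 Ui K1 x t =
    Ui + K1 * W 1 (x / lam_a1 * t `^ (- a)).
  by move=> t0; rewrite affine_sim_gt0// selfsim1.
have dr (t : R) : 0 < t -> is_derive t 1 (r eta) (2 * eta * lam_a1 * (a * t `^ (a - 1))).
  by move=> t0; apply: is_derive_mull; exact: is_derive1_powR.
have r_cvg0 : r eta t @[t --> 0^'+] --> 0.
  rewrite -[X in _ --> X](mulr0 (2 * eta * lam_a1)).
  by apply: cvgM; [exact: cvg_cst|exact: powR_cvg0].
have lim2 (t : R) : 0 < t -> RL_D alpha (d_dx (affine_sim alpha lam_a2 (U0 - K2) K2)) x t
    @[x --> (r eta t)^'-] --> - (K2 / lam_a2) * selfsim alpha lam_a2 a (r eta t) t.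
  by move=> t0; apply: RL_D_affine_sim_cvg => //; [exact: r0|exact: cvg_within].
have lim1 (t : R) : 0 < t -> RL_D alpha (d_dx (affine_sim alpha lam_a1 Ui K1)) x t
    @[x --> (r eta t)^'+] --> - (K1 / lam_a1) * selfsim alpha lam_a1 a (r eta t) t.
  by move=> t0; apply: RL_D_affine_sim_cvg => //; [exact: r0|exact: cvg_within].
have open0T (p : R * R) : (`]0, +oo[ `*` `]0, T[) p -> 0 < p.2.
  by case=> _; rewrite /= in_itv/= => /andP[].
split.
- by apply: affine_sim_continuous_in2 => // p [_ /andP[]].
- apply: (@bounded_at_originP _ _ U0) => [p [/andP[x0 xr] /andP[t0 _]]|].
    have y0 : 0 <= p.1 / lam_a2 * p.2 `^ (- a) by rewrite mulr_ge0 ?powR_ge0// divr_ge0// ltW.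
    have yr : p.1 / lam_a2 * p.2 `^ (- a) <= 2 * eta * lam.
      by rewrite -(ry2 _ t0) ler_wpM2r ?powR_ge0// ler_wpM2r// invr_ge0 ltW.
    rewrite w2E//; apply/andP; split; last first.
      by rewrite gerBl mulr_ge0 ?(ltW K20)// subr_ge0 wrightN1_le1.
    have h : K2 * (1 - W 1 (p.1 / lam_a2 * p.2 `^ (- a))) <= U0 - Um.
      have -> : U0 - Um = K2 * (1 - M2) by rewrite /K2 divfK// lt0r_neq0.
      rewrite ler_pM2l// lerD2l lerN2 wrightN_nonincreasing ?y0//.
      by move: a_lt => ?; lra.
    by rewrite ge_min; apply/orP; right; lra.
  apply: (@curve_meets _ _ (fun=> 0) T) => //; first exact: cvg_cst.
  by move=> t tT /=; rewrite lexx (ltW (r0 _ _))//; case/andP: tT.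
- by apply: affine_sim_continuous_in2 => // p [_ /andP[]].
- apply: (@bounded_at_originP _ _ (Ui + K1)) => [p [xr /andP[t0 _]]|].
    have x0 : 0 < p.1 := lt_trans (r0 _ t0) xr.
    have y0 : 0 <= p.1 / lam_a1 * p.2 `^ (- a) by rewrite mulr_ge0 ?powR_ge0// divr_ge0// ltW.
    rewrite w1E//; apply/andP; split.
      by rewrite ge_min lerDl mulr_ge0 ?orbT ?(ltW K10) ?wrightN_ge0.
    by rewrite lerD2l ler_piMr ?(ltW K10)// wrightN1_le1.
  apply: (@curve_meets _ _ (fun t => r eta t + t) T) => //.
    rewrite -[X in _ --> X](addr0 0); apply: cvgD => //.
    by apply: cvg_at_right_filter; exact: cvg_id.
  by move=> t /andP[t0 tT] /=; rewrite ltrDl t0.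
- exact: affine_sim_continuous_in2.
- exact: affine_sim_C2.
- by move=> x x0; apply: affine_sim_abs_cont => // t; rewrite /= in_itv/= => /andP[/ltW].
- exact: affine_sim_continuous_in2.
- exact: affine_sim_C2.
- move=> x x0; split => [t /andP[t0 _]|].
    exact: is_derive_derivable (is_derive_affine_sim_x lam_a2 al0 al1 _ _ x t0).
  by apply: affine_sim_abs_cont => // t; rewrite /= in_itv/= => /andP[].
- split=> [t /andP[t0 _]|]; first exact: is_derive_derivable (dr t t0).
  apply: continuous_in_subspaceT => t; rewrite inE/= in_itv/= => /andP[t0 _].
  have h : 2 * eta * lam_a1 * (a * s `^ (a - 1)) @[s --> t] -->
      2 * eta * lam_a1 * (a * t `^ (a - 1)).
    apply: cvgM; first exact: cvg_cst.
    apply: cvgM; first exact: cvg_cst.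
    exact: is_derive_continuous (is_derive1_powR (a - 1) t0).
  suff : derive1 (r eta) @ t --> derive1 (r eta) t by [].
  rewrite (is_derive_derive1 (dr t t0)); apply: cvg_trans h; apply: near_eq_cvg.
  near=> s; apply/esym/is_derive_derive1/dr; near: s; exact: lt_nbhsr.
- move=> t /andP[t0 _]; split; last by apply/cvg_ex; eexists; exact: lim2.
  near=> x; apply: has_RL_D_affine_sim => //; apply: ltW; near: x.
  by apply: nbhs_left_gt; exact: r0.
- move=> t /andP[t0 _]; split; last by apply/cvg_ex; eexists; exact: lim1.
  near=> x; apply: has_RL_D_affine_sim => //; apply: ltW.
  by apply: (lt_trans (r0 t t0)); near: x; exact: nbhs_right_gt.
- by move=> x t /andP[x0 _] /andP[t0 _]; exact: affine_sim_pde.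
- by move=> x t rx /andP[t0 _]; apply: affine_sim_pde => //; exact: lt_trans (r0 t t0) rx.
- by move=> x _; rewrite affine_sim_time0.
- move=> t /andP[t0 _]; rewrite w2E// !mul0r /W wrightN1_0 subrr mulr0 subr0//.
- move=> t /andP[t0 _]; rewrite w1E// w2E// ry1// ry2// -/M1 -/M2; split.
    by rewrite /K1 divfK ?lt0r_neq0//; ring.
  by rewrite /K2 divfK ?lt0r_neq0//; ring.
- move=> t /andP[t0 _]; split; first exact: is_derive_derivable (dr t t0).
  rewrite (is_derive_derive1 (dr t t0)) (cvg_lim _ (lim1 t t0))// (cvg_lim _ (lim2 t t0))//.
  rewrite /selfsim -/a ry1// ry2// -/W.
  have key : rho * l * (2 * eta) =
      a^-1 * (A * (W a (2 * eta * lam) / (1 - M2)) - B * (W a (2 * eta) / M1)).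
    have hG1 : G1 alpha (2 * eta) = a^-1 * (W a (2 * eta) / M1) - 2 * eta.
      by rewrite -(G1E al0 al1 (ltW e2)) addrK.
    move: Heta; rewrite G2E hG1 -/a -/W [2 * lam * eta]mulrAC -/M2 => h; lra.
  have -> : rho * l * (2 * eta * lam_a1 * (a * t `^ (a - 1))) =
      (rho * l * (2 * eta)) * (a * lam_a1 * t `^ (a - 1)) by ring.
  rewrite key /A /B /K1 /K2.
  have n1 := lt0r_neq0 a0; have n2 := lt0r_neq0 L1; have n3 := lt0r_neq0 L2.
  have n4 := lt0r_neq0 M10; have n5 := lt0r_neq0 M20.
  by apply: stefan_balance.
- by rewrite /r powR0 ?mulr0// gt_eqF.
Unshelve. all: try by end_near.
Qed.
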